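(* Let $\mathcal{P}_1,\dots,\mathcal{P}_m\subset\mathbb{R}^d$ ($m\ge2$) be lattice polytopes of dimension $d$, and suppose that each $\mathcal{P}_i$ satisfies $\sum_{\mathbf{a}\in\mathcal{P}_i\cap\mathbb{Z}^d}\mathbb{Z}(\mathbf{a},1)=\mathbb{Z}^{d+1}$. If the toric ideal $I_{\mathcal{P}_1*\cdots*\mathcal{P}_m}$ possesses a squarefree initial ideal of degree at most $\ell$, then $I_{\mathcal{P}_1+\cdots+\mathcal{P}_m}$ possesses a squarefree initial ideal of degree at most $\ell$, and both $\mathcal{P}_1*\cdots*\mathcal{P}_m$ and $\mathcal{P}_1+\cdots+\mathcal{P}_m$ have a regular unimodular triangulation and the integer decomposition property.
   Context: The Cayley sum $\mathcal{P}_1*\cdots*\mathcal{P}_m\subset\mathbb{R}^{d+m-1}$ is the convex hull of $(\mathcal{P}_1\times\{\mathbf{e}_1\})\cup\cdots\cup(\mathcal{P}_{m-1}\times\{\mathbf{e}_{m-1}\})\cup(\mathcal{P}_m\times\{\mathbf{0}\})$, where $\mathbf{e}_j$ are the standard unit vectors of $\mathbb{R}^{m-1}$. The Minkowski sum is $\mathcal{P}_1+\cdots+\mathcal{P}_m=\{\mathbf{x}_1+\cdots+\mathbf{x}_m:\mathbf{x}_i\in\mathcal{P}_i\}$. For a lattice polytope $\mathcal{P}\subset\mathbb{R}^n$ with $\mathcal{P}\cap\mathbb{Z}^n=\{\mathbf{a}_1,\dots,\mathbf{a}_N\}$ and a field $K$, the toric ideal $I_{\mathcal{P}}$ is the kernel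 of the ring homomorphism $K[x_1,\dots,x_N]\to K[t_1^{\pm1},\dots,t_n^{\pm1},s]$, $x_i\mapsto \mathbf{t}^{\mathbf{a}_i}s$. ''Possesses a squarefree initial ideal of degree at most $\ell$'' means there is a monomial order for which the initial ideal of $I_{\mathcal{P}}$ is generated by squarefree monomials of degree at most $\ell$. A lattice polytope $\mathcal{P}\subset\mathbb{R}^n$ has the integer decomposition property if $\mathcal{P}\cap\mathbb{Z}^n+k\mathcal{P}\cap\mathbb{Z}^n=(k+1)\mathcal{P}\cap\mathbb{Z}^n$ for all integers $k\ge1$. *)

(* Defs.v *)
From HB Require Import structures.
From mathcomp Require Import all_boot all_order all_algebra.
From mathcomp Require Import finmap.
From mathcomp Require Import boolp classical_sets reals.
From mathcomp Require Import mpoly.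

Set Implicit Arguments.
Unset Strict Implicit.
Unset Printing Implicit Defensive.

Import Order.TTheory GRing.Theory Num.Theory.

Local Open Scope classical_set_scope.
Local Open Scope ring_scope.

(** * Convex geometry in R^n *)

Section Geometry.
Variables (R : realType) (n : nat).
Implicit Types (S P : set 'rV[R]_n) (z : 'rV[int]_n).

Definition conv S : set 'rV[R]_n :=
  [set x | exists (k : nat) (w : 'I_k -> R) (p : 'I_k -> 'rV[R]_n),
    [/\ forall i, 0 <= w i, \sum_i w i = 1, forall i, S (p i)
      & x = \sum_i w i *: p i]].

Definition aff_hull S : set 'rV[R]_n :=
  [set x | exists (k : nat) (w : 'I_k -> R) (p : 'I_k -> 'rV[R]_n),
    [/\ \sum_i w i = 1, forall i, S (p i) & x = \sum_i w i *: p i]].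

(* The dimension of S is that of its affine hull x0 + U. *)
Definition has_dim S (k : nat) : Prop :=
  exists (x0 : 'rV[R]_n) (U : {vspace 'rV[R]_n}),
    aff_hull S = [set x0 + u | u in [set u | u \in U]] /\ \dim U = k.

Definition int_vec z : 'rV[R]_n := map_mx intr z.

(* Simplices below are given by their finite sets of (integral) vertices. *)
Definition real_points (s : {fset 'rV[int]_n}) : set 'rV[R]_n :=
  [set int_vec z | z in [set` s]].

Definition lattice_polytope P : Prop :=
  exists V : {fset 'rV[int]_n}, P = conv (real_points V).

Definition lattice_points P : set 'rV[int]_n := [set z | P (int_vec z)].

Definition dilate (k : nat) P : set 'rV[R]_n := [set k%:R *: x | x in P].

Definition IDP P : Prop :=
  forall k : nat, (1 <= k)%N ->
    [set a + b | a in lattice_points P & b in lattice_points (dilate k P)]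
    = lattice_points (dilate k.+1 P).

Definition affinely_independent (s : {fset 'rV[int]_n}) : Prop :=
  forall c : 'rV[int]_n -> R,
    \sum_(a <- s) c a = 0 -> \sum_(a <- s) c a *: int_vec a = 0 ->
    forall a, a \in s -> c a = 0.

(* The cells include the empty simplex, which is a face of every simplex. *)
Definition triangulation P (T : set {fset 'rV[int]_n}) : Prop :=
  [/\ forall s, T s ->
        [set` s] `<=` lattice_points P /\ affinely_independent s,
      forall s t, T s -> (t `<=` s)%fset -> T t,
      forall s t, T s -> T t ->
        conv (real_points s) `&` conv (real_points t)
        = conv (real_points (s `&` t)%fset)
    & \bigcup_(s in T) conv (real_points s) = P].

(* The cells are the projections of the lower faces of the convex hull of the
   lifted lattice points (a, w a); a lower face is cut out by a supporting
   affine function x |-> x c + c0. *)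
Definition regular P (T : set {fset 'rV[int]_n}) : Prop :=
  exists w : 'rV[int]_n -> R, forall s : {fset 'rV[int]_n},
    T s <->
    [set` s] `<=` lattice_points P /\
    exists (c : 'cV[R]_n) (c0 : R), forall a, lattice_points P a ->
      if a \in s then (int_vec a *m c) 0 0 + c0 = w a
      else (int_vec a *m c) 0 0 + c0 < w a.

(* The vertices form an affine basis of the lattice of integral points of the
   affine hull of the simplex. *)
Definition unimodular (s : {fset 'rV[int]_n}) : Prop :=
  affinely_independent s /\
  forall z, aff_hull (real_points s) (int_vec z) ->
    exists c : 'rV[int]_n -> int,
      \sum_(a <- s) c a = 1 /\ z = \sum_(a <- s) a *~ c a.

Definition has_regular_unimodular_triangulation P : Prop :=
  exists T : set {fset 'rV[int]_n},
    [/\ triangulation P T, regular P T & forall s, T s -> unimodular s].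

End Geometry.

Definition int_span (V : zmodType) (S : set V) : set V :=
  [set v | exists s : seq (int * V),
    (forall u, u \in s -> S u.2) /\ v = \sum_(u <- s) u.2 *~ u.1].

(* The integer combinations of the vectors (a, 1), a in P \cap Z^n, make up
   Z^(n + 1). *)
Definition lattice_spanning (R : realType) (n : nat) (P : set 'rV[R]_n) : Prop :=
  int_span [set row_mx a (const_mx 1 : 'rV[int]_1) | a in lattice_points P]
  = [set: 'rV[int]_(n + 1)].

Section Sums.
Variables (R : realType) (d m : nat) (P : 'I_m -> set 'rV[R]_d).

(* With indices starting from 0, this is the i-th unit vector of R^(m - 1) when
   i < m - 1, and 0 when i = m - 1. *)
Definition cayley_vec (i : 'I_m) : 'rV[R]_(m.-1) :=
  \row_(j < m.-1) (j == i :> nat)%:R.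

Definition cayley_sum : set 'rV[R]_(d + m.-1) :=
  conv (\bigcup_(i in [set: 'I_m]) [set row_mx x (cayley_vec i) | x in P i]).

Definition minkowski_sum : set 'rV[R]_d :=
  [set x | exists y : 'I_m -> 'rV[R]_d,
    (forall i, P i (y i)) /\ x = \sum_i y i].

End Sums.

(** * Initial ideals and toric ideals *)

Definition ideal_generated (A : comNzRingType) (S : set A) : set A :=
  [set p | exists s : seq (A * A),
    (forall u, u \in s -> S u.2) /\ p = \sum_(u <- s) u.1 * u.2].

Section Toric.
Variable K : fieldType.

Definition monomial_order (N : nat) (ord : rel 'X_{1..N}) : Prop :=
  [/\ total ord, antisymmetric ord, transitive ord,
      forall u v w : 'X_{1..N}, ord u v -> ord (u + w)%MM (v + w)%MM
    & forall u : 'X_{1..N}, ord 0%MM u].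

Definition initial_monomial (N : nat) (ord : rel 'X_{1..N})
    (f : {mpoly K[N]}) (u : 'X_{1..N}) : Prop :=
  u \in msupp f /\ forall v, v \in msupp f -> ord v u.

Definition initial_ideal (N : nat) (ord : rel 'X_{1..N})
    (I : set {mpoly K[N]}) : set {mpoly K[N]} :=
  ideal_generated [set g | exists f u,
    [/\ I f, initial_monomial ord f u & g = 'X_[u]]].

(* The Laurent polynomial ring K[t_1^(+-1), ..., t_n^(+-1), s] is viewed inside
   its fraction field K(t_1, ..., t_n, s); s is the last variable. *)
Local Notation laurent_field n := {fraction {mpoly K[(n + 1)%N]}}.

Definition laurent_const (n : nat) (c : K) : laurent_field n :=
  tofrac (c%:MP_[n + 1]).

Definition laurent_var (n : nat) (i : 'I_(n + 1)) : laurent_field n :=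
  tofrac ('X_i : {mpoly K[n + 1]}).

(* t^a s *)
Definition laurent_monomial (n : nat) (a : 'rV[int]_n) : laurent_field n :=
  (\prod_(j < n) laurent_var (lshift 1 j) ^ a 0 j) * laurent_var (rshift n 0).

Definition toric_ideal (n N : nat) (a : 'I_N -> 'rV[int]_n) :
    set {mpoly K[N]} :=
  [set p | mmap (@laurent_const n) (fun i => laurent_monomial (a i)) p = 0].

(* The toric ideal of P is that of an enumeration a_1, ..., a_N of the lattice
   points of P; it does not depend on the enumeration up to a renaming of the
   variables. *)
Definition has_squarefree_initial_ideal (R : realType) (n : nat)
    (P : set 'rV[R]_n) (l : nat) : Prop :=
  exists (N : nat) (a : 'I_N -> 'rV[int]_n),
    [/\ injective a, lattice_points P = range a &
      exists (ord : rel 'X_{1..N}) (G : set 'X_{1..N}),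
        [/\ monomial_order ord,
            forall u, G u -> (forall i, (u i <= 1)%N) /\ (mdeg u <= l)%N
          & initial_ideal ord (toric_ideal a)
            = ideal_generated [set 'X_[u] | u in G]]].

End Toric.

(* Main.v *)
(* Fibres of the monomial map u |-> sum_i u_i (a_i, 1) turn everything into
   combinatorics: x^u lies outside the initial ideal iff u is the smallest
   monomial of its fibre (it is standard), and the initial ideal is squarefree
   iff being standard only depends on the support.

   A squarefree initial ideal is induced by an integral weight w, by Motzkin's
   transposition theorem.  The standard supports are the cells of the regular
   subdivision given by w, whose lifting functions come from the same theorem.
   They are unimodular: if q e lies in the lattice spanned by a standard support
   s, write e = u - v; the standard forms of u + k s and v + k s are supported,
   for k large, on standard sets containing s, and uniqueness of standard forms
   divides the relation by q.

   For the Minkowski sum, give every lattice point b the variable z_b and the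
   standard monomial phi(z_b) = x_{1,a_1} ... x_{m,a_m} with a_1 + ... + a_m = b.
   Order monomials in the z_b by their images under phi, and break ties so that
   products along chains of the product order on tuples (a_1, ..., a_m) come
   first.  Sorting shows that every standard monomial of multidegree (k, ..., k)
   is the image of exactly one product along a chain.  Hence z^u is standard iff
   phi(z^u) is standard and the support of u is a chain, which is forbidden by
   squarefree monomials of degree at most max(l, 2).  If l < 2 the Cayley sum has
   no relation at all, and then there are no incomparable tuples. *)

Require Import Defs.
From mathcomp Require Import all_boot all_order all_algebra.
From mathcomp Require Import finmap.
From mathcomp Require Import boolp classical_sets reals.
From mathcomp Require Import mpoly.
From mathcomp Require Import zify ring lra.

Set Implicit Arguments.
Unset Strict Implicit.
Unset Printing Implicit Defensive.

Import Order.TTheory GRing.Theory Num.Theory.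

Local Open Scope ring_scope.

(** * Motzkin's transposition theorem *)

(** The bridge between the two polytopes is the multidegree (1, ..., 1): a lattice point z of the
    Minkowski sum gives the lattice point (z, 1, ..., 1) of the m-th dilate of the Cayley sum. So
    normality of the Cayley sum, a consequence of its unimodular cells, is needed before tuples can
    be assigned to the variables z_b: it is what writes z as a sum of lattice points of the
    summands.

    Motzkin's theorem is applied over the rationals because its second alternative has to be read,
    after clearing denominators, as an equality of two products of monomials or as an integral
    relation inside one fibre. Real points come back to this setting because the rank of a rational
    matrix does not depend on the field.

    Ties between products of tuples cannot be broken by a weight that is linear in the tuples: meet
    and join have the same total rank as the pair that they replace. A strictly convex function of
    the rank separates them, whence the squares in [wsq]. *)

Section Motzkin.
Variable F : realFieldType.

(* One step of Fourier-Motzkin elimination. *)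
Lemma separating_point (I : finType) (S : pred I) (x b : I -> F) :
  (forall i, x i = 0 -> if S i then 0 < b i else 0 <= b i) ->
  (forall i j, 0 < x i -> x j < 0 ->
    if S i || S j then 0 < x i * b j - x j * b i
    else 0 <= x i * b j - x j * b i) ->
  exists t, forall i, if S i then 0 < x i * t + b i else 0 <= x i * t + b i.
Proof.
move=> H0 Hp.
(* Each inequality bounds t by its root: from below if [x i > 0], from above if [x i < 0]. *)
pose r i : F := - b i / x i.
have rE i t : x i != 0 -> x i * t + b i = x i * (t - r i).
  by move=> xi; rewrite /r; field.
suff [t Ht] : exists t : F, forall i,
    (0 < x i -> if S i then r i < t else r i <= t) /\
    (x i < 0 -> if S i then t < r i else t <= r i).
  exists t => i; case: (ltrgtP (x i) 0) => xi.
  - rewrite rE ?lt_eqF //; have [_ /(_ xi)] := Ht i.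
    case: (S i) => h; first by rewrite nmulr_rgt0 // subr_lt0.
    by rewrite nmulr_rge0 // subr_le0.
  - rewrite rE ?gt_eqF //; have [/(_ xi) + _] := Ht i.
    case: (S i) => h; first by rewrite pmulr_rgt0 // subr_gt0.
    by rewrite pmulr_rge0 // subr_ge0.
  - by rewrite xi mul0r add0r; apply: H0.
have Hr i j : 0 < x i -> x j < 0 -> if S i || S j then r i < r j else r i <= r j.
  move=> xi xj; have := Hp i j xi xj.
  have -> : x i * b j - x j * b i = (- (x i * x j)) * (r j - r i).
    by rewrite /r; field; rewrite (lt_eqF xj) (gt_eqF xi).
  have xx : 0 < - (x i * x j) by rewrite oppr_gt0 pmulr_rlt0.
  by case: ifP => _; rewrite ?(pmulr_rgt0, pmulr_rge0) // ?subr_gt0 ?subr_ge0.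
have [[i0 xi0]|nopos] := pselect (exists i, 0 < x i); last first.
  have np i : ~ 0 < x i by move=> h; apply: nopos; exists i.
  have [[j0 xj0]|noneg] := pselect (exists j, x j < 0); last first.
    by exists 0 => i; split => xi; [case: (np i)|case: noneg; exists i].
  case: (@arg_minP _ F I j0 (fun j => x j < 0) r xj0) => j xj jmin.
  exists (r j - 1) => i; split => xi; first by case: (np i).
  have h1 : r j <= r i := jmin _ xi.
  by case: (S i); lra.
case: (@arg_maxP _ F I i0 (fun i => 0 < x i) r xi0) => i xi imax.
have [[j0 xj0]|noneg] := pselect (exists j, x j < 0); last first.
  exists (r i + 1) => k; split => xk; last by case: noneg; exists k.
  have h1 : r k <= r i := imax _ xk.
  by case: (S k); lra.
case: (@arg_minP _ F I j0 (fun j => x j < 0) r xj0) => j xj jmin.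
(* The largest lower bound [r i] and the smallest upper bound [r j] may coincide; a strict bound
   [r k] then still differs from them, by [Hr] against a bound on the other side. *)
exists ((r i + r j) / 2) => k; split => xk.
  have h1 : r k <= r i := imax _ xk.
  have h2 := Hr _ _ xk xj; have h3 := Hr _ _ xi xj.
  have h4 : r i <= r j by move: h3; case: ifP => _ //; exact: ltW.
  by move: h2; case: (S k) => /= h2; lra.
have h1 : r j <= r k := jmin _ xk.
have h2 := Hr _ _ xi xk; have h3 := Hr _ _ xi xj.
have h4 : r i <= r j by move: h3; case: ifP => _ //; exact: ltW.
by move: h2; rewrite orbC; case: (S k) => /= h2; lra.
Qed.

Lemma motzkin_ord (n : nat) (I : finType) (S : pred I) (v : I -> 'I_n -> F) :
  (exists y : 'I_n -> F, forall i,
     if S i then 0 < \sum_j v i j * y j else 0 <= \sum_j v i j * y j) \/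
  (exists c : I -> F, [/\ forall i, 0 <= c i, exists i, S i && (0 < c i)
     & forall j, \sum_i c i * v i j = 0]).
Proof.
elim: n I S v => [|n IHn] I S v.
  have [[i0 Si0]|noS] := pselect (exists i, S i).
    right; exists (fun i => (i == i0)%:R); split => [i||[]//].
      by rewrite ler0n.
    by exists i0; rewrite Si0 eqxx ltr01.
  left; exists (fun=> 0) => i; rewrite big_ord0.
  by case: ifP => // Si; case: noS; exists i.
pose x i := v i ord0; pose v1 i j := v i (lift ord0 j).
pose J := (I + I * I)%type.
pose ok (p : I * I) := (0 < x p.1) && (x p.2 < 0).
(* Indices that yield no inequality, [inl i] with [x i != 0] and [inr p] without [ok p], stay as the
   trivial 0 <= 0. *)
pose S' (k : J) := match k with
  | inl i => (x i == 0) && S i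
  | inr p => ok p && (S p.1 || S p.2) end.
(* The multipliers that produce the k-th inequality of the eliminated system. *)
pose cl (k : J) i : F := match k with
  | inl i' => if (x i' == 0) && (i == i') then 1 else 0
  | inr p => if ok p then
      (if i == p.2 then x p.1 else 0) - (if i == p.1 then x p.2 else 0)
      else 0 end.
pose v' (k : J) j := \sum_i cl k i * v1 i j.
have clP (f : I -> F) k : \sum_i cl k i * f i = match k with
  | inl i => if x i == 0 then f i else 0
  | inr p => if ok p then x p.1 * f p.2 - x p.2 * f p.1 else 0 end.
  case: k => [i|p] /=.
    case: (x i == 0); last by rewrite big1 // => j _; rewrite mul0r.
    rewrite (bigD1 i) //= eqxx mul1r big1 ?addr0 // => j /negbTE ->.
    by rewrite mul0r.
  case: (ok p); last by rewrite big1 // => j _; rewrite mul0r.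
  under eq_bigr do rewrite mulrBl.
  rewrite sumrB; congr (_ - _).
    by rewrite (bigD1 p.2) //= eqxx big1 ?addr0 // => j /negbTE ->; rewrite mul0r.
  by rewrite (bigD1 p.1) //= eqxx big1 ?addr0 // => j /negbTE ->; rewrite mul0r.
case: (IHn J S' v') => [[y Hy]|[c [c0 [k /andP[Sk ck]] Hc]]].
  left; pose b i := \sum_j v1 i j * y j.
  have bE k : \sum_j v' k j * y j = \sum_i cl k i * b i.
    under eq_bigr do rewrite mulr_suml.
    rewrite exchange_big; apply: eq_bigr => i _; rewrite mulr_sumr.
    by apply: eq_bigr => j _; rewrite mulrA.
  case: (@separating_point I S x b) => [i xi|i j xi xj|t Ht].
  - by have := Hy (inl i); rewrite bE clP /= xi eqxx.
  - by have := Hy (inr (i, j)); rewrite bE clP /= /ok /= xi xj.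
  exists (fun j => if unlift ord0 j is Some j' then y j' else t) => i.
  rewrite big_ord_recl unlift_none; have := Ht i; rewrite /b.
  by under [in X in _ -> X]eq_bigr do rewrite liftK.
right; exists (fun i => \sum_k c k * cl k i); split.
- move=> i; apply: sumr_ge0 => [[i'|p]] _ /=; apply: mulr_ge0 => //.
    by case: ifP.
  case: ifP => // /andP[/ltW p1 /ltW p2].
  by case: ifP => _; case: ifP => _; lra.
- have clge0 k' i : 0 <= cl k' i.
    case: k' => [i'|p] /=; case: ifP => // /andP[/ltW p1 /ltW p2].
    by case: ifP => _; case: ifP => _; lra.
  have [i /andP[Si cli]] : exists i, S i && (0 < cl k i).
    case: k Sk {ck} => [i|p] /= /andP[okp].
      by move=> Si; exists i; rewrite Si okp eqxx ltr01.
    have /andP[p1 p2] := okp.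
    case/orP => Sp.
      exists p.1; rewrite Sp okp eqxx /=.
      by case: eqP => _; lra.
    exists p.2; rewrite Sp okp eqxx /=.
    by case: eqP => _; lra.
  exists i; rewrite Si (bigD1 k) //=; apply: ltr_pwDl; first exact: mulr_gt0.
  by apply: sumr_ge0 => k' _; apply: mulr_ge0.
move=> j; under eq_bigr do rewrite mulr_suml.
rewrite exchange_big /=.
under eq_bigr do (under eq_bigr do rewrite -mulrA; rewrite -mulr_sumr).
case: (unliftP ord0 j) => [j' ->|->]; first exact: Hc.
rewrite big1 // => k' _; rewrite -/x (clP x).
case: k' => [i|p] /=; case: ifP => [|_]; rewrite ?mulr0 //.
  by move/eqP => ->; rewrite mulr0.
by move=> _; rewrite (mulrC (x p.2)) subrr mulr0.
Qed.

Lemma motzkin (J I : finType) (S : pred I) (v : I -> J -> F) :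
  (exists y : J -> F, forall i,
     if S i then 0 < \sum_j v i j * y j else 0 <= \sum_j v i j * y j) \/
  (exists c : I -> F, [/\ forall i, 0 <= c i, exists i, S i && (0 < c i)
     & forall j, \sum_i c i * v i j = 0]).
Proof.
case: (motzkin_ord S (fun i (j : 'I_#|J|) => v i (enum_val j))) => [[y Hy]|].
  left; exists (fun j => y (enum_rank j)) => i.
  rewrite (reindex (@enum_val J predT)) /=; last exact/onW_bij/enum_val_bij.
  by under eq_bigr do rewrite enum_valK; exact: Hy.
case=> c [c0 cS cE]; right; exists c; split => // j.
by have := cE (enum_rank j); under eq_bigr do rewrite enum_rankK.
Qed.

End Motzkin.

Lemma common_denominator (I : finType) (c : I -> rat) :
  exists q (z : I -> int), (0 < q)%N /\ forall i, c i = (z i)%:~R / q%:R.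
Proof.
pose q := (\prod_i `|denq (c i)|)%N.
have q0 : (0 < q)%N by rewrite prodn_gt0 // => i; rewrite absz_gt0 denq_neq0.
exists q, (fun i => numq (c i) * (\prod_(j | j != i) `|denq (c j)|)%N%:Z).
split=> // i; pose p := (\prod_(j | j != i) `|denq (c j)|)%N.
have -> : q = (`|denq (c i)| * p)%N by rewrite /q (bigD1 i).
rewrite -/p intrM natrM -pmulrn.
have h1 : (`|denq (c i)|%N%:R : rat) = (denq (c i))%:~R.
  by rewrite -[in RHS](gez0_abs (denq_ge0 _)) pmulrn.
rewrite h1 -{1}[c i]divq_num_den; field.
rewrite intr_eq0 denq_neq0 /= pnatr_eq0 -lt0n prodn_gt0 // => j.
by rewrite absz_gt0 denq_neq0.
Qed.

(** * Toric ideals and standard monomials *)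

Local Open Scope classical_set_scope.

Section Fibers.
Variables (n N : nat) (a : 'I_N -> 'rV[int]_n).

Definition homogenize (z : 'rV[int]_n) : 'rV[int]_(n + 1) :=
  row_mx z (const_mx 1).

(* The exponent vector of the image of x^u in the Laurent polynomial ring. *)
Definition expo (u : 'X_{1..N}) : 'rV[int]_(n + 1) :=
  \sum_i homogenize (a i) *+ u i.

Definition fiber u v := expo u = expo v.

Definition standard (ord : rel 'X_{1..N}) u := forall v, fiber u v -> ord u v.

Lemma expo0 : expo 0%MM = 0.
Proof. by rewrite /expo big1 // => i _; rewrite mnm0E. Qed.

Lemma expoD u v : expo (u + v)%MM = expo u + expo v.
Proof.
by rewrite /expo -big_split; apply: eq_bigr => i _; rewrite mnmDE mulrnDr.
Qed.

Lemma expoMn u k : expo (u *+ k)%MM = expo u *+ k.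
Proof.
by elim: k => [|k IH]; rewrite ?mulm0n ?expo0 // mulmS expoD IH mulrS.
Qed.

Lemma expo1 i : expo U_(i)%MM = homogenize (a i).
Proof.
rewrite /expo (bigD1 i) //= mnm1E eqxx big1 ?addr0 // => j ji.
by rewrite mnm1E eq_sym (negbTE ji).
Qed.

Lemma expo_mdeg u : expo u 0 (rshift n 0) = (mdeg u)%:Z.
Proof.
rewrite /expo summxE mdegE (big_morph Posz PoszD (erefl (Posz 0))).
by apply: eq_bigr => i _; rewrite mulmxnE row_mxEr mxE natz.
Qed.

Lemma expo_lshift u j : expo u 0 (lshift 1 j) = (\sum_i a i *+ u i) 0 j.
Proof.
rewrite /expo !summxE; apply: eq_bigr => i _.
by rewrite !mulmxnE row_mxEl.
Qed.

(** The last coordinate of every homogenized point is 1. This homogeneity makes the fibres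
    finite. *)
Lemma fiber_mdeg u v : fiber u v -> mdeg u = mdeg v.
Proof.
by move=> /(congr1 (fun e : 'rV_(n + 1) => e 0 (rshift n 0)));
  rewrite !expo_mdeg => -[].
Qed.

End Fibers.

Section ToricIdeal.
Variables (K : fieldType) (n N : nat) (a : 'I_N -> 'rV[int]_n).

Let LF := {fraction {mpoly K[(n + 1)%N]}}.
Let lv (j : 'I_(n + 1)) : LF := laurent_var K j.
Let ev := mmap (@laurent_const K n) (fun i => laurent_monomial K (a i)).

Lemma laurent_var_neq0 j : lv j != 0.
Proof.
rewrite /lv /laurent_var tofrac_eq0; apply/eqP => /(congr1 (mcoeff U_(j)%MM)).
by move/eqP; rewrite mcoeffX eqxx mcoeff0 oner_eq0.
Qed.

Lemma laurent_monomialE z :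
  laurent_monomial K z = \prod_j lv j ^ homogenize z 0 j.
Proof.
rewrite /laurent_monomial big_split_ord big_ord1 /= row_mxEr mxE expr1z.
by congr (_ * _); apply: eq_bigr => j _; rewrite row_mxEl.
Qed.

Lemma mmap1_laurent u :
  mmap1 (fun i => laurent_monomial K (a i)) u = \prod_j lv j ^ expo a u 0 j.
Proof.
rewrite /mmap1; transitivity
  (\prod_i \prod_j (lv j ^ homogenize (a i) 0 j) ^+ u i).
  by apply: eq_bigr => i _; rewrite prodrXl -laurent_monomialE.
rewrite exchange_big; apply: eq_bigr => j _ /=.
rewrite /expo summxE.
under [in RHS]eq_bigr do rewrite mulmxnE.
elim/big_ind2: _ => [|x1 x2 y1 y2 -> ->|i _]; first by rewrite expr0z.
  by rewrite expfzDr ?laurent_var_neq0.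
by rewrite exprnP exprz_exp -natz mulr_natr.
Qed.

Lemma evE p : ev p = \sum_(u <- msupp p)
  tofrac (p@_u)%:MP * \prod_j lv j ^ expo a u 0 j.
Proof. by rewrite /ev /mmap; apply: eq_bigr => u _; rewrite mmap1_laurent. Qed.

Lemma toric_binomial u v :
  fiber a u v -> @toric_ideal K _ _ a ('X_[u] - 'X_[v]).
Proof.
move=> uv; rewrite /toric_ideal /=.
have -> : mmap (@laurent_const K n) = mmap (@tofrac _ \o @mpolyC (n + 1) K) by [].
by rewrite mmapB !mmapX !mmap1_laurent uv subrr.
Qed.

(** Distinct Laurent monomials are linearly independent: if u were alone in its fibre within the
    support of f, its coefficient could not be cancelled. *)
Lemma toric_support f u : @toric_ideal K _ _ a f -> u \in msupp f ->
  exists v, [/\ v \in msupp f, v <> u & fiber a u v].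
Proof.
move=> f0 uf; apply: contrapT => nov.
have {}nov v : v \in msupp f -> v != u -> expo a v != expo a u.
  move=> vf /eqP vu; apply/eqP => e; apply: nov; exists v; split => //.
(* Multiplication by the k-th power of every variable makes all exponents that occur nonnegative,
   which moves the relation into the polynomial ring. *)
pose k := (\sum_(v <- msupp f) \sum_j `|expo a v 0%R j|)%N.
pose sh v := [multinom `|(expo a v 0 j + k%:Z)%R|%N | j < n + 1].
have kP v j : v \in msupp f -> 0 <= expo a v 0 j + k%:Z.
  move=> vf; have : (`|expo a v 0%R j| <= k)%N.
    rewrite /k (big_rem v) //= (bigD1 j) //= -addnA; exact: leq_addr.
  lia.
have shE v j : v \in msupp f -> (sh v j)%:Z = expo a v 0 j + k%:Z.
  by move=> vf; rewrite mnmE gez0_abs // kP.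
pose T := \prod_j lv j ^+ k.
have : tofrac (\sum_(v <- msupp f) f@_v *: 'X_[sh v]) = 0 :> LF.
  rewrite rmorph_sum /= -[RHS](mulr0 T).
  rewrite -[X in _ = _ * X]f0 [X in _ = _ * X]evE mulr_sumr.
  rewrite !big_seq; apply: eq_bigr => v vf.
  rewrite -mul_mpolyC tofracM mulrCA; congr (_ * _).
  rewrite mpolyXE_id rmorph_prod /T -big_split /=; apply: eq_bigr => j _ /=.
  rewrite rmorphXn /= -[X in X = _]/(lv j ^+ _) !exprnP shE // addrC.
  by rewrite expfzDr ?laurent_var_neq0.
move/eqP; rewrite tofrac_eq0 => /eqP /(congr1 (mcoeff (sh u))).
rewrite mcoeff0 raddf_sum /= (bigD1_seq u) ?msupp_uniq //= big_seq_cond big1.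
  rewrite addr0 mcoeffZ mcoeffX eqxx mulr1 => /eqP.
  by rewrite mcoeff_eq0 uf.
move=> v /andP[vf vu]; rewrite mcoeffZ mcoeffX; case: eqP; rewrite ?mulr0 //.
move=> shv; case/eqP: (nov _ vf vu); apply/rowP => j.
by apply: (addIr k%:Z); rewrite -!shE // shv.
Qed.

Lemma monomial_idealP (S : set 'X_{1..N}) (p : {mpoly K[N]}) :
  ideal_generated [set 'X_[u] | u in S] p <->
  forall u, u \in msupp p -> exists2 g, S g & (g <= u)%MM.
Proof.
split=> [[s [sS ->]] u|H].
  move/msupp_sum_le => /flatten_mapP [q]; rewrite filter_predT => qs.
  have [g Sg <-] := sS _ qs.
  rewrite (perm_mem (msuppMX _ _)) => /mapP[w _ ->].
  by exists g => //; exact: lem_addr.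
have /choice [g gP] : forall u, exists g, u \in msupp p -> S g /\ (g <= u)%MM.
  move=> u; have [/H [g Sg gu]|up] := boolP (u \in msupp p); first by exists g.
  by exists u.
exists [seq (p@_u *: 'X_[u - g u], 'X_[g u]) | u <- msupp p]; split.
  by move=> _ /mapP[u up ->]; exists (g u) => //; case: (gP u up).
rewrite big_map [LHS]mpolyE !big_seq; apply: eq_bigr => u up /=.
have [_ gu] := gP u up.
by rewrite -scalerAl -mpolyXD submK.
Qed.

(** A leading monomial shares its fibre with a smaller monomial of f, by [toric_support].
    Conversely, a smaller v in the fibre of u gives the binomial x^u - x^v. *)
Lemma initial_toricP ord u : monomial_order ord ->
  (exists f, @toric_ideal K _ _ a f /\ initial_monomial ord f u) <->
  ~ standard a ord u.
Proof.
move=> [tot anti tr _ _]; split=> [[f [If [uf lead]]] st|].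
  have [v [vf vu fuv]] := toric_support If uf.
  by apply: vu; apply: anti; rewrite (lead _ vf) (st _ fuv).
move/existsNP => [v /not_implyP [fuv /negP nuv]].
have ltvu : ord v u by have := tot u v; rewrite (negbTE nuv).
have uv : u != v by apply: contraNneq nuv => ->; have := tot v v; rewrite orbb.
have refl w : ord w w by have := tot w w; rewrite orbb.
exists ('X_[u] - 'X_[v]); split; first exact: toric_binomial.
split=> [|w].
  rewrite mcoeff_msupp mcoeffB !mcoeffX eqxx [v == u]eq_sym (negbTE uv) subr0.
  exact: oner_neq0.
rewrite mcoeff_msupp mcoeffB !mcoeffX.
case: (u =P w) => [<- //|_]; case: (v =P w) => [<- //|_].
by rewrite subrr eqxx.
Qed.

End ToricIdeal.

Section StandardMonomials.
Variables (n N : nat) (a : 'I_N -> 'rV[int]_n) (ord : rel 'X_{1..N}).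
Hypothesis ordP : monomial_order ord.

(** Replacing the factor v of u by a smaller monomial of its fibre would give a smaller monomial in
    the fibre of u. *)
Lemma standard_le u v : (v <= u)%MM -> standard a ord u -> standard a ord v.
Proof.
case: ordP => tot anti _ mon _ vu stu v' fv.
case/orP: (tot v v') => // lt.
have /stu h1 : fiber a u (u - v + v')%MM.
  by rewrite /fiber -{1}(submK vu) !expoD fv.
have h2 : ord (u - v + v')%MM u.
  by rewrite -{2}(submK vu) !(addmC (u - v)%MM); apply: mon.
have /eqP : (u - v + v')%MM = u by apply: anti; rewrite h1 h2.
by rewrite -{2}(submK vu) eqm_add2l => /eqP ->; have := tot v v; rewrite orbb.
Qed.

Lemma standard_uniq u v :
  standard a ord u -> standard a ord v -> fiber a u v -> u = v.
Proof.
case: ordP => _ anti _ _ _ su sv uv.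
by apply: anti; rewrite su //= sv.
Qed.

End StandardMonomials.

(** Removes the field K: the initial ideal is spanned by the nonstandard monomials, and a set of
    monomials generates it exactly when its multiples are the nonstandard monomials. *)
Lemma squarefree_initial_idealP (K : fieldType) (R : realType) (n : nat)
    (P : set 'rV[R]_n) l :
  has_squarefree_initial_ideal K P l <->
  exists (N : nat) (a : 'I_N -> 'rV[int]_n),
    [/\ injective a, lattice_points P = range a &
      exists (ord : rel 'X_{1..N}) (G : set 'X_{1..N}),
        [/\ monomial_order ord,
            forall u, G u -> (forall i, (u i <= 1)%N) /\ (mdeg u <= l)%N
          & forall u, ~ standard a ord u <-> exists2 g, G g & (g <= u)%MM]].
Proof.
have key N (a : 'I_N -> 'rV[int]_n) ord : monomial_order ord ->
    [set g : {mpoly K[N]} | exists f u, [/\ @toric_ideal K _ _ a f,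
       initial_monomial ord f u & g = 'X_[u]]] =
    [set 'X_[u] | u in [set u | ~ standard a ord u]].
  move=> ordP; apply/seteqP; split => [_ [f [u [If uf ->]]]|_ [u Nu <-]] /=.
    by exists u => //=; apply/(initial_toricP K a u ordP); exists f.
  by have [f [If uf]] := (initial_toricP K a u ordP).2 Nu; exists f, u.
split=> -[N [a [inj Pa [ord [G [ordP Gsq GE]]]]]];
  exists N, a; split=> //; exists ord, G; split=> //.
  move=> u; move: GE; rewrite /initial_ideal key // => /seteqP [s1 s2].
  have uu : u \in msupp ('X_[u] : {mpoly K[N]}) by rewrite msuppX inE.
  split=> [Nu|[g Gg gu]].
    have /s1 /monomial_idealP : ideal_generated
        [set 'X_[u] | u in [set u | ~ standard a ord u]] ('X_[u] : {mpoly K[N]}).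
      by apply/monomial_idealP => v; rewrite msuppX inE => /eqP ->;
        exists u => //; exact: lepm_refl.
    by move=> /(_ u uu).
  have /s2 /monomial_idealP : ideal_generated
      [set 'X_[u] | u in G] ('X_[u] : {mpoly K[N]}).
    by apply/monomial_idealP => v; rewrite msuppX inE => /eqP ->; exists g.
  by move=> /(_ u uu) [g' Ng' g'u] su; apply: Ng'; apply: standard_le su.
rewrite /initial_ideal key //; apply/seteqP.
split=> p /monomial_idealP H; apply/monomial_idealP => u /H [g].
  move=> /((GE g).1) [g' Gg' g'g] gu; exists g' => //.
  exact: lepm_trans gu.
by move=> Gg gu; exists u; [apply/(GE u); exists g|exact: lepm_refl].
Qed.

Local Close Scope classical_set_scope.

(** * Weights and lifting functions *)

Lemma seq_min (T : eqType) (r : rel T) (s : seq T) x :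
  total r -> transitive r -> x \in s -> exists2 y, y \in s & {in s, forall z, r y z}.
Proof.
move=> tot tr; elim: s x => [//|x s IHs] x' _.
have refl y : r y y by have := tot y y; rewrite orbb.
have [[z zs]|nos] := pselect (exists z, z \in s); last first.
  exists x => [|z]; rewrite in_cons ?eqxx //.
  by case: eqP => [-> //|_ /= zs]; case: nos; exists z.
have [y ys ymin] := IHs z zs.
case/orP: (tot x y) => [xy|yx].
  exists x => [|t]; rewrite in_cons ?eqxx //.
  by case: eqP => [-> //|_ /= /ymin]; apply: tr.
exists y => [|t]; rewrite in_cons ?ys ?orbT //.
by case: eqP => [-> //|_ /= /ymin].
Qed.

Section WeightedDegree.
Variables (N : nat).

Definition wdeg (w : 'I_N -> int) (u : 'X_{1..N}) : int := \sum_i w i *+ u i.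

Lemma wdegD w u v : wdeg w (u + v)%MM = wdeg w u + wdeg w v.
Proof.
by rewrite /wdeg -big_split; apply: eq_bigr => i _; rewrite mnmDE mulrnDr.
Qed.

Definition mnm_ind (s : {set 'I_N}) : 'X_{1..N} := [multinom (i \in s : nat) | i < N].

Definition mnm_supp (u : 'X_{1..N}) : {set 'I_N} := [set i | u i != 0%N].

Lemma mnm_indE s i : mnm_ind s i = (i \in s).
Proof. by rewrite mnmE. Qed.

Lemma mnm_supp_ind s : mnm_supp (mnm_ind s) = s.
Proof. by apply/setP => i; rewrite inE mnm_indE eqb0 negbK. Qed.

Lemma mnm_ind_supp_le u : (mnm_ind (mnm_supp u) <= u)%MM.
Proof. by apply/mnm_lepP => i; rewrite mnm_indE inE; case: (u i). Qed.

Lemma mnm_ind_le s u : (mnm_ind s <= u)%MM = (s \subset mnm_supp u).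
Proof.
apply/mnm_lepP/fintype.subsetP => [H i si|H i].
  by rewrite inE; have := H i; rewrite mnm_indE si lt0n.
by have := H i; rewrite mnm_indE inE; case: (i \in s) => // /(_ isT); case: (u i).
Qed.

End WeightedDegree.

Section Configuration.
Variables (n N : nat) (a : 'I_N -> 'rV[int]_n) (ord : rel 'X_{1..N}).
Hypothesis ordP : monomial_order ord.
Local Notation std := (standard a ord).

(** A fibre is finite, being contained in one degree. Only a total preorder is required, so that the
    lemma serves both [ord] and the comparison of weights. *)
Lemma fiber_min (r : rel 'X_{1..N}) u : total r -> transitive r ->
  exists2 v, fiber a u v & forall v', fiber a u v' -> r v v'.
Proof.
move=> tot tr.
pose s := [seq val m | m <- enum {: 'X_{1..N < (mdeg u).+1}} &
             expo a (val m) == expo a u].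
have sP v : v \in s <-> fiber a u v.
  split=> [/mapP[m]|uv].
    by rewrite mem_filter => /andP[/eqP e _] ->.
  have dv : (mdeg v < (mdeg u).+1)%N by rewrite ltnS (fiber_mdeg uv).
  apply/mapP; exists (BMultinom dv) => //.
  by rewrite mem_filter /= mem_enum andbT; apply/eqP.
have /(seq_min tot tr) [v /sP uv vmin] : u \in s by apply/sP.
by exists v => // v' /sP; apply: vmin.
Qed.

Lemma standard_form u : exists2 v, fiber a u v & std v.
Proof.
case: ordP => tot _ tr _ _; have [v uv vmin] := fiber_min u tot tr.
by exists v => // v' vv'; apply: vmin; rewrite /fiber uv.
Qed.

Hypothesis std_squarefree : forall u, std (mnm_ind (mnm_supp u)) -> std u.

Lemma standard_supp u v : mnm_supp u \subset mnm_supp v -> std v -> std u.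
Proof.
rewrite -mnm_ind_le => uv sv.
exact: std_squarefree (standard_le ordP uv sv).
Qed.

Lemma standard_sub (s t : {set 'I_N}) :
  s \subset t -> std (mnm_ind t) -> std (mnm_ind s).
Proof. by move=> st; apply: standard_supp; rewrite !mnm_supp_ind. Qed.

Lemma standard_in (s : {set 'I_N}) u :
  mnm_supp u \subset s -> std (mnm_ind s) -> std u.
Proof. by move=> us; apply: standard_supp; rewrite mnm_supp_ind. Qed.

Lemma ord_sum (I : Type) (r : seq I) (Q : pred I) (F G : I -> 'X_{1..N}) :
  (forall i, ord (F i) (G i)) ->
  ord (\big[mnm_add/0%MM]_(i <- r | Q i) F i)
      (\big[mnm_add/0%MM]_(i <- r | Q i) G i).
Proof.
case: ordP => tot _ tr mon _ FG; elim/big_ind2: _ => // [|x1 x2 y1 y2 h1 h2].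
  by have := tot 0%MM 0%MM; rewrite orbb.
apply: (tr (x1 + y2)%MM); first exact: mon.
by rewrite !(addmC x1); apply: mon.
Qed.

(* Otherwise, by Motzkin's theorem, some product of initial monomials equals
   the product of their smaller normal forms. *)
Lemma reducing_weight : exists w : 'I_N -> int, forall (s : {set 'I_N}) v,
  ~ std (mnm_ind s) -> fiber a (mnm_ind s) v -> std v ->
  wdeg w v < wdeg w (mnm_ind s).
Proof.
case: (ordP) => tot anti tr mon _.
have /choice [sf sfP] : forall u, exists v, fiber a u v /\ std v.
  by move=> u; have [v] := standard_form u; exists v.
pose S (s : {set 'I_N}) := `[< ~ std (mnm_ind s) >].
pose V (s : {set 'I_N}) i : rat := (mnm_ind s i)%:R - (sf (mnm_ind s) i)%:R.
have sf_le u : ord (sf u) u.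
  by have [uv sv] := sfP u; apply: sv; rewrite /fiber uv.
case: (motzkin S V) => [[y Hy]|[c [c0 [s0 /andP[/asboolP Ss0 cs0]] Hc]]].
  have [q [z [q0 yz]]] := common_denominator y.
  exists z => s v Ns sv stv.
  have -> : v = sf (mnm_ind s).
    have [f1 f2] := sfP (mnm_ind s).
    exact: (standard_uniq ordP stv f2 (etrans (esym sv) f1)).
  have := Hy s; have -> : S s by apply/asboolP.
  have -> : \sum_i V s i * y i =
      (wdeg z (mnm_ind s) - wdeg z (sf (mnm_ind s)))%:~R / q%:R.
    rewrite intrB /wdeg !rmorph_sum /=. rewrite -sumrB mulr_suml; apply: eq_bigr => i _ /=.
    by rewrite yz /V -!(mulr_natl (z i)) !intrM !natz -!pmulrn mulrA mulrBl.
  by rewrite pmulr_lgt0 ?invr_gt0 ?ltr0n // ltr0z subr_gt0.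
have [q [z [q0 cz]]] := common_denominator c.
pose k s := `|z s|%N.
have kz s : c s = (k s)%:R / q%:R.
  rewrite cz /k [in RHS]pmulrn gez0_abs //.
  have := c0 s; rewrite cz pmulr_lge0 ?invr_gt0 ?ltr0n //.
  by rewrite ler0z.
(* The certificate, cleared of denominators, says that the product A of squarefree monomials equals
   the product B of their normal forms. *)
pose A := (\big[mnm_add/0]_s (mnm_ind s *+ k s))%MM.
pose B := (\big[mnm_add/0]_s (sf (mnm_ind s) *+ k s))%MM.
have AB : A = B.
  apply/mnmP => i; rewrite /A /B !mnm_sumE.
  under eq_bigr do rewrite mulmnE.
  under [in RHS]eq_bigr do rewrite mulmnE.
  apply/eqP; rewrite -(eqr_nat rat) -subr_eq0 !natr_sum -sumrB.
  have := Hc i; rewrite /V => /eqP.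
  under eq_bigr => s _ do rewrite kz mulrAC mulrBr -!natrM ![(k s * _)%N]mulnC.
  by rewrite -mulr_suml mulf_eq0 invr_eq0 pnatr_eq0 (gtn_eqF q0) orbF.
have ks0 : (0 < k s0)%N.
  by move: cs0; rewrite kz pmulr_lgt0 ?invr_gt0 ?ltr0n.
have leMn u v m : ord u v -> ord (u *+ m)%MM (v *+ m)%MM.
  move=> uv; elim: m => [|m IH]; first by rewrite !mulm0n; have := tot 0%MM 0%MM; rewrite orbb.
  rewrite !mulmS; apply: (tr (v + u *+ m)%MM); first exact: mon.
  by rewrite !(addmC v); apply: mon.
pose A' := (\big[mnm_add/0]_(s | s != s0) (mnm_ind s *+ k s))%MM.
pose B' := (\big[mnm_add/0]_(s | s != s0) (sf (mnm_ind s) *+ k s))%MM.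
have AE : A = (mnm_ind s0 + (mnm_ind s0 *+ (k s0).-1 + A'))%MM.
  by rewrite /A (bigD1 s0) //= -{1}(prednK ks0) mulmS -addmA.
have BE : B = (sf (mnm_ind s0) + (sf (mnm_ind s0) *+ (k s0).-1 + B'))%MM.
  by rewrite /B (bigD1 s0) //= -{1}(prednK ks0) mulmS -addmA.
set X := (_ + A')%MM in AE; set Y := (_ + B')%MM in BE.
have YX : ord Y X.
  apply: (tr (mnm_ind s0 *+ (k s0).-1 + B')%MM); first by apply/mon/leMn.
  rewrite /X !(addmC (_ *+ _)%MM); apply/mon/ord_sum => s; exact: leMn.
(* One copy of [s0] was set apart: as Y precedes X, the equality A = B puts [mnm_ind s0 + Y] before
   [sf (mnm_ind s0) + Y], and the reverse comparison is clear. Cancelling Y makes [s0] standard. *)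
case: Ss0; suff -> : mnm_ind s0 = sf (mnm_ind s0) by case: (sfP (mnm_ind s0)).
apply: (@addIm _ Y); apply: anti; apply/andP; split; last exact: mon.
by rewrite -BE -AB AE !(addmC (mnm_ind s0)); apply: mon.
Qed.

(** The finitely many squarefree reductions suffice: a nonstandard u has a nonstandard squarefree
    part, and replacing this factor by its normal form lowers the weight. So every minimizer of the
    weight on a fibre is standard, hence there is only one. *)
Lemma standard_weight : exists w : 'I_N -> int, forall u v,
  std u -> fiber a u v -> v <> u -> wdeg w u < wdeg w v.
Proof.
have [w wP] := reducing_weight; exists w.
have minstd u : (forall v, fiber a u v -> wdeg w u <= wdeg w v) -> std u.
  move=> umin; apply: contrapT => Nu.
  have Ns : ~ std (mnm_ind (mnm_supp u)) by move/std_squarefree.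
  have [v sv stv] := standard_form (mnm_ind (mnm_supp u)).
  have := wP _ _ Ns sv stv; rewrite ltNge => /negP; apply.
  have uE := submK (mnm_ind_supp_le u); set r := (u - _)%MM in uE.
  have fr : fiber a u (r + v)%MM by rewrite /fiber -[in LHS]uE !expoD sv.
  by have := umin _ fr; rewrite -[in X in X <= _]uE !wdegD lerD2l.
move=> u v su uv vu.
have [|v' uv' v'min] := @fiber_min (fun x y => wdeg w x <= wdeg w y) u _
  (fun y x z => @le_trans _ _ (wdeg w y) (wdeg w x) (wdeg w z)).
  by move=> x y; apply: le_total.
have stv' : std v' by apply: minstd => x xv; apply: v'min; rewrite /fiber uv'.
have uE : u = v' := standard_uniq ordP su stv' uv'.
subst v'; rewrite lt_neqAle v'min // andbT; apply/eqP => e.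
apply: vu; apply: esym; apply: (standard_uniq ordP su _ uv).
apply: minstd => x xv.
by rewrite -e; apply: v'min; rewrite /fiber uv.
Qed.

End Configuration.

Lemma sum_unit (V : nmodType) (F : unit -> V) : \sum_i F i = F tt.
Proof. by rewrite (big_pred1 tt) // => -[]. Qed.

Section IntegerRelations.
Variables (N : nat).
Implicit Types (z : 'I_N -> int).

(** An integral relation z between the points is handled as the pair of monomials [mnm_pos z] and
    [mnm_pos (- z)], which lie in one fibre. *)
Definition mnm_pos z : 'X_{1..N} := [multinom `|Num.max (z i) 0|%N | i < N].

Lemma mnm_posE z i : (mnm_pos z i)%:Z = Num.max (z i) 0.
Proof. by rewrite mnmE gez0_abs // le_max lexx orbT. Qed.

Lemma mnm_posB z i : (mnm_pos z i)%:Z - (mnm_pos (fun i => - z i) i)%:Z = z i.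
Proof. rewrite !mnm_posE; lia. Qed.

Lemma wdeg_posB w z :
  wdeg w (mnm_pos z) - wdeg w (mnm_pos (fun i => - z i)) = \sum_i z i * w i.
Proof.
rewrite /wdeg -sumrB; apply: eq_bigr => i _.
by rewrite -!(mulr_natl (w i)) -mulrBl !natz mnm_posB.
Qed.

End IntegerRelations.

(** * Independence, lifting functions and unimodularity of standard supports *)

Section StandardCones.
Variables (n N : nat) (a : 'I_N -> 'rV[int]_n) (ord : rel 'X_{1..N}).
Hypothesis ordP : monomial_order ord.
Local Notation std := (standard a ord).
Hypothesis std_squarefree : forall u, std (mnm_ind (mnm_supp u)) -> std u.
Variable w : 'I_N -> int.
Hypothesis wP : forall u v, std u -> fiber a u v -> v <> u -> wdeg w u < wdeg w v.

Definition hcoord i j : int := homogenize (a i) 0 j.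
Local Notation A := hcoord.

Lemma expo_hcoord u j : expo a u 0 j = wdeg (A^~ j) u.
Proof. by rewrite /expo summxE; apply: eq_bigr => i _; rewrite mulmxnE. Qed.

Lemma fiberP u v : fiber a u v <-> forall j, wdeg (A^~ j) u = wdeg (A^~ j) v.
Proof.
split=> [uv j|H]; first by rewrite -!expo_hcoord uv.
by apply/rowP => j; rewrite !expo_hcoord.
Qed.

Lemma fiber_pos z : (forall j, \sum_i z i * A i j = 0) ->
  fiber a (mnm_pos z) (mnm_pos (fun i => - z i)).
Proof.
by move=> H; apply/fiberP => j; apply/eqP; rewrite -subr_eq0 wdeg_posB H.
Qed.

(** The negative part of z is supported on s, hence standard, hence the unique minimizer of the
    weight in its fibre. The positive part lies in the same fibre and is not heavier, so both
    coincide. *)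
Lemma standard_relation (s : {set 'I_N}) z : std (mnm_ind s) ->
  (forall j, \sum_i z i * A i j = 0) -> (forall i, z i < 0 -> i \in s) ->
  \sum_i z i * w i <= 0 -> forall i, z i = 0.
Proof.
move=> ss zA zs zw i.
have sv : std (mnm_pos (fun i => - z i)).
  apply: (standard_in ordP std_squarefree) ss.
  apply/fintype.subsetP => k; rewrite inE => zk; apply: zs.
  by have := mnm_posE (fun i => - z i) k; lia.
have fuv := fiber_pos zA.
have [e|ne] := pselect (mnm_pos z = mnm_pos (fun i => - z i)).
  by rewrite -mnm_posB e subrr.
have := wP sv (esym fuv) ne.
by rewrite -subr_gt0 wdeg_posB ltNge zw.
Qed.

(** One of z and - z has nonpositive weight, so [standard_relation] applies to it. *)
Lemma standard_relation0 (s : {set 'I_N}) z : std (mnm_ind s) ->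
  (forall j, \sum_i z i * A i j = 0) -> (forall i, i \notin s -> z i = 0) ->
  forall i, z i = 0.
Proof.
move=> ss zA zs i.
have [le|gt] := leP (\sum_i z i * w i) 0.
  apply: standard_relation ss zA _ le _ => k; apply: contraTT => /zs ->.
  by rewrite ltxx.
apply/eqP; rewrite -oppr_eq0; apply/eqP.
apply: (@standard_relation s (fun i => - z i)) => //.
- by move=> j; under eq_bigr do rewrite mulNr; rewrite sumrN zA oppr0.
- by move=> k; apply: contraTT => /zs ->; rewrite oppr0 ltxx.
- by under eq_bigr do rewrite mulNr; rewrite sumrN oppr_le0 ltW.
Qed.

(** Motzkin's theorem in the unknowns y and t, where t > 0 homogenizes the right-hand sides and
    equality on s is split into two inequalities. A certificate would be a relation [la],
    nonnegative off s and of weight [- c (inr tt) <= 0]. It vanishes by [standard_relation], which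
    leaves no strict inequality with a positive coefficient. *)
Lemma lifting_function (s : {set 'I_N}) : std (mnm_ind s) ->
  exists y : 'I_(n + 1) -> rat, forall i,
    if i \in s then \sum_j y j * (A i j)%:~R = (w i)%:~R
    else \sum_j y j * (A i j)%:~R < (w i)%:~R.
Proof.
move=> ss.
pose I := ('I_N + 'I_N + unit)%type; pose J := (unit + 'I_(n + 1))%type.
pose S (k : I) := match k with
  | inl (inl i) => i \notin s | inl (inr i) => false | inr _ => true end.
pose C i (j : J) : rat := match j with
  | inl _ => (w i)%:~R | inr j => - (A i j)%:~R end.
pose V (k : I) (j : J) : rat := match k with
  | inl (inl i) => C i j
  | inl (inr i) => if i \in s then - C i j else 0
  | inr _ => if j is inl _ then 1 else 0 end.
have sumJ (F : J -> rat) : \sum_j F j = F (inl tt) + \sum_j F (inr j).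
  by rewrite big_sumType /= sum_unit.
case: (motzkin S V) => [[y Hy]|[c [c0 [k ck] Hc]]].
  have t0 : 0 < y (inl tt).
    have := Hy (inr tt); rewrite /= sumJ /= mul1r big1 ?addr0 // => j _.
    by rewrite mul0r.
  pose g i := \sum_j y (inr j) * (A i j)%:~R.
  have gE i : \sum_j C i j * y j = (w i)%:~R * y (inl tt) - g i.
    rewrite sumJ /=; congr (_ + _); rewrite /g -sumrN.
    by apply: eq_bigr => j _; rewrite mulNr mulrC.
  exists (fun j => y (inr j) / y (inl tt)) => i.
  have -> : \sum_j y (inr j) / y (inl tt) * (A i j)%:~R = g i / y (inl tt).
    by rewrite /g mulr_suml; apply: eq_bigr => j _; rewrite mulrAC.
  have := Hy (inl (inl i)); have := Hy (inl (inr i)); rewrite /= gE.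
  case: (i \in s) => /=.
    under eq_bigr do rewrite mulNr.
    rewrite sumrN gE => h1 h2; apply/eqP.
    rewrite eq_le ler_pdivrMr // ler_pdivlMr //; apply/andP; split; lra.
  by move=> _ h; rewrite ltr_pdivrMr //; lra.
pose la i : rat := c (inl (inl i)) - (if i \in s then c (inl (inr i)) else 0).
have sumI (f : 'I_N -> rat) (e : rat) :
    \sum_(k : I) c k * match k with
       | inl (inl i) => f i | inl (inr i) => if i \in s then - f i else 0
       | inr _ => e end = \sum_i la i * f i + c (inr tt) * e.
  rewrite !big_sumType /= sum_unit; congr (_ + _).
  rewrite -big_split; apply: eq_bigr => i _ /=; rewrite /la.
  by case: ifP => _; ring.
have laA j : \sum_i la i * (A i j)%:~R = 0.
  have := sumI (fun i => C i (inr j)) 0; rewrite (Hc (inr j)) mulr0 addr0 /=.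
  by under eq_bigr do rewrite mulrN; rewrite sumrN => /esym/eqP; rewrite oppr_eq0 => /eqP.
have law : \sum_i la i * (w i)%:~R = - c (inr tt).
  have := sumI (fun i => C i (inl tt)) 1; rewrite (Hc (inl tt)) mulr1 /=.
  by move/esym/eqP; rewrite addr_eq0 => /eqP.
have [q [z [q0 laz]]] := common_denominator la.
have qn0 : (q%:R : rat) != 0 by rewrite pnatr_eq0 -lt0n.
have q0' : (0 : rat) < q%:R^-1 by rewrite invr_gt0 ltr0n.
have zla (f : 'I_N -> int) :
    (\sum_i z i * f i)%:~R = (\sum_i la i * (f i)%:~R) * q%:R :> rat.
  rewrite rmorph_sum mulr_suml; apply: eq_bigr => i _ /=.
  by rewrite intrM laz; field.
have z0 i : z i = 0.
  apply: (standard_relation ss).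
  - move=> j; apply/eqP; rewrite -(intr_eq0 rat) (zla (A^~ j)) laA mul0r //.
  - move=> k'; apply: contraTT => ks; rewrite -leNgt -(ler0z rat).
    have := c0 (inl (inl k')); rewrite -[c _]subr0.
    have -> : c (inl (inl k')) - 0 = la k' by rewrite /la (negbTE ks).
    by rewrite laz pmulr_lge0.
  - rewrite -(lerz0 rat) zla law pmulr_lle0 ?ltr0n // oppr_le0; exact: c0.
have la0 i : la i = 0 by rewrite laz z0 mul0r.
have ctt : c (inr tt) = 0.
  apply/eqP; rewrite -oppr_eq0 -law big1 // => i _.
  by rewrite la0 mul0r.
case: k ck => [[i|i]|[]] /andP[] //= ; last by rewrite ctt ltxx.
move=> ins; have := la0 i; rewrite /la (negbTE ins) subr0 => ->.
by rewrite ltxx.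
Qed.

Lemma standard0 : std 0%MM.
Proof.
move=> v /fiber_mdeg; rewrite mdeg0 => /esym/eqP; rewrite mdeg_eq0 => /eqP ->.
by case: ordP => tot _ _ _ _; have := tot 0%MM 0%MM; rewrite orbb.
Qed.

(* The weight of std(v + k s) - k s decreases with k, strictly as long as s is
   not a face of a standard support; a lifting function bounds it below. *)
Lemma standard_stabilize (s : {set 'I_N}) v : std (mnm_ind s) ->
  exists k f, fiber a f (v + mnm_ind s *+ k)%MM /\ std (mnm_ind (s :|: mnm_supp f)).
Proof.
move=> ss; have [y Hy] := lifting_function ss.
have /choice [f fP] : forall k, exists f, fiber a (v + mnm_ind s *+ k)%MM f /\ std f.
  by move=> k; have [f] := standard_form a ordP (v + mnm_ind s *+ k)%MM; exists f.
pose L u : rat := \sum_j y j * (expo a u 0 j)%:~R.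
have LE u : L u = \sum_i (u i)%:R * \sum_j y j * (A i j)%:~R.
  rewrite /L; under eq_bigr do rewrite expo_hcoord /wdeg rmorph_sum mulr_sumr.
  rewrite exchange_big; apply: eq_bigr => i _; rewrite mulr_sumr.
  apply: eq_bigr => j _ /=; rewrite -(mulr_natl (A i j)) intrM natz -pmulrn; ring.
have LD u u' : L (u + u')%MM = L u + L u'.
  rewrite /L -big_split; apply: eq_bigr => j _ /=.
  by rewrite expoD mxE intrD mulrDr.
have LM u k : L (u *+ k)%MM = L u * k%:R.
  elim: k => [|k IH]; last by rewrite mulmS LD IH -[k.+1]add1n natrD; ring.
  by rewrite mulm0n mulr0 LE big1 // => i _; rewrite mnm0E mul0r.
have wE u : (wdeg w u)%:~R = \sum_i (u i)%:R * (w i)%:~R :> rat.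
  rewrite /wdeg rmorph_sum; apply: eq_bigr => i _ /=.
  by rewrite -(mulr_natl (w i)) intrM natz -pmulrn.
have Lle u : L u <= (wdeg w u)%:~R.
  rewrite LE wE; apply: ler_sum => i _; apply: ler_wpM2l; first exact: ler0n.
  by have := Hy i; case: ifP => _ => [->//|]; exact: ltW.
have Ls : L (mnm_ind s) = (wdeg w (mnm_ind s))%:~R.
  rewrite LE wE; apply: eq_bigr => i _; rewrite mnm_indE.
  by have := Hy i; case: ifP => _ => [->//|]; rewrite !mul0r.
apply: contrapT => nok.
have step k : wdeg w (f k.+1) + 1 <= wdeg w (f k) + wdeg w (mnm_ind s).
  have [fk sk] := fP k; have [fk1 sk1] := fP k.+1.
  have fib : fiber a (f k.+1) (f k + mnm_ind s)%MM.
    by rewrite /fiber -fk1 [RHS]expoD -fk -expoD mulmSr addmA.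
  (* If s times the k-th normal form is already standard, its support is a standard set that
     contains both s and the support of [f k]. *)
  have [e|ne] := pselect ((f k + mnm_ind s)%MM = f k.+1).
    case: nok; exists k, (f k); split; first exact: esym.
    apply: (standard_supp ordP std_squarefree) sk1.
    rewrite mnm_supp_ind -e; apply/fintype.subsetP => i.
    by rewrite !inE mnmDE mnm_indE addn_eq0 negb_and eqb0 negbK orbC.
  have := wP sk1 fib ne; rewrite wdegD; lia.
have down k : wdeg w (f k) + k%:Z <= wdeg w (f 0%N) + wdeg w (mnm_ind s) * k%:Z.
  elim: k => [|k IH]; first by rewrite mulr0 !addr0.
  have := step k; rewrite intS; lia.
have bound k : L v + k%:R <= (wdeg w (f 0%N))%:~R.
  have := down k; rewrite -(ler_int rat) !intrD intrM -!pmulrn => h.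
  have := Lle (f k); have [fk _] := fP k.
  have -> : L (f k) = L v + L (mnm_ind s) * k%:R.
    by rewrite -LM -LD /L -fk.
  rewrite Ls; lra.
set x := (wdeg w (f 0%N))%:~R - L v.
have h1 := archi_boundP (normr_ge0 x); have h2 := ler_norm x.
by have := bound (Num.bound `|x|); rewrite /x in h1 h2 *; lra.
Qed.

(** Saturation: the lattice of a standard support has no torsion quotient in the lattice of all the
    points. *)
Lemma standard_unimodular (s : {set 'I_N}) (e r : 'I_N -> int) q :
  std (mnm_ind s) -> (0 < q)%N -> (forall i, i \notin s -> r i = 0) ->
  (forall j, q%:Z * \sum_i e i * A i j = \sum_i r i * A i j) ->
  exists r' : 'I_N -> int,
    (forall i, i \notin s -> r' i = 0) /\ forall i, r i = q%:Z * r' i.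
Proof.
move=> ss q0 rs erE.
pose M := (\sum_i `|r i|)%N.
have rM i : (`|r i| <= M)%N by rewrite /M (bigD1 i) //= leq_addr.
(* Adding M copies of s to u puts q M copies into t, enough to make [r + q M] nonnegative on s. Then
   u to the power q and v to the power q times t lie in one fibre. *)
pose u := (mnm_pos e + mnm_ind s *+ M)%MM; pose v := mnm_pos (fun i => - e i).
pose t : 'X_{1..N} := [multinom `|(r i + (q * M * (i \in s))%N%:Z)%R|%N | i < N].
have tE i : (t i)%:Z = r i + (q * M * (i \in s))%N%:Z.
  rewrite mnmE gez0_abs //; have [si|/rs ->] := boolP (i \in s); last by [].
  have := rM i; nia.
have uv j : wdeg (A^~ j) (u *+ q)%MM = wdeg (A^~ j) (v *+ q + t)%MM.
  have wdegE x : wdeg (A^~ j) x = \sum_i (x i)%:Z * A i j.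
    by apply: eq_bigr => i _; rewrite -(mulr_natl (A i j)) natz.
  apply/eqP; rewrite -subr_eq0 !wdegE -sumrB.
  have H := erE j; move/eqP: H; rewrite -subr_eq0 mulr_sumr -sumrB => /eqP H.
  apply/eqP; rewrite -[RHS]H; apply: eq_bigr => i _.
  rewrite mulmnE !mnmDE mulmnE PoszD tE -!mulrBl.
  have := mnm_posB e i; rewrite -/v mulmnE mnm_indE => h.
  rewrite mulrA -mulrBl; congr (_ * _).
  rewrite -h !PoszM !PoszD !PoszM; ring.
have [k1 [f1 [fib1 st1]]] := standard_stabilize v ss.
have [k2 [f2 [fib2 st2]]] := standard_stabilize u ss.
(* The extra copies of s bring both sides to q (k1 + k2) copies. Both monomials are standard, since
   [f1] and [f2] are supported on standard sets that contain s; comparing exponents on s shows that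
   q divides r. *)
pose l := (f2 *+ q + mnm_ind s *+ (q * k1))%MM.
pose m := (f1 *+ q + (mnm_ind s *+ (q * k2) + t))%MM.
have lm : l = m.
  apply: (standard_uniq ordP).
  - apply: (standard_in ordP std_squarefree) st2.
    apply/fintype.subsetP => i; rewrite !inE mnmDE !mulmnE mnm_indE.
    by case: (i \in s); case: (f2 i) => //=; rewrite mul0n.
  - apply: (standard_in ordP std_squarefree) st1.
    apply/fintype.subsetP => i; rewrite !inE !mnmDE !mulmnE mnm_indE.
    have := tE i; case: (boolP (i \in s)) => //= /rs ->.
    by rewrite muln0 addr0 => -[->]; case: (f1 i) => //=; rewrite mul0n.
  - apply/fiberP => j.
    have Mn x k : wdeg (A^~ j) (x *+ k)%MM = wdeg (A^~ j) x *+ k.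
      by rewrite -!expo_hcoord expoMn mulmxnE.
    have /fiberP /(_ j) := fib1; have /fiberP /(_ j) := fib2.
    have := uv j; rewrite [wdeg _ l]wdegD [wdeg _ m]wdegD.
    rewrite (wdegD _ u) (wdegD _ v) (wdegD _ (v *+ q)%MM).
    rewrite (wdegD _ (mnm_ind s *+ (q * k2))%MM) !Mn => h3 h2 h1.
    rewrite h1 h2 !mulrnDl -!mulrnA h3 ![(q * _)%N]mulnC; lia.
exists (fun i => if i \in s then (f2 i)%:Z - (f1 i)%:Z + k1%:Z - k2%:Z - M%:Z else 0).
split=> [i /negbTE -> //|i]; case: ifP => [si|/negbT/rs ->]; last by rewrite mulr0.
have := congr1 (fun x : 'X_{1..N} => (x i)%:Z) lm.
rewrite /l /m !mnmDE !mulmnE mnm_indE si !mul1n !PoszD tE si muln1 !PoszM => h.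
lia.
Qed.

End StandardCones.

(** * Coordinates on cells and linear programming *)

Section RationalCoordinates.
Variables (N k : nat) (A : 'I_N -> 'I_k -> int) (s : {set 'I_N}).

(* The last N columns force the coefficients outside s to vanish. *)
Let constraint_mx (F : fieldType) : 'M[F]_(N, k + N) :=
  row_mx (\matrix_(i, j) (A i j)%:~R) (diag_mx (\row_i (i \notin s)%:R)).

Let constraint_mxP (F : fieldType) (c : 'I_N -> F) (x : 'I_k -> F) :
  (\row_i c i) *m constraint_mx F = row_mx (\row_j x j) 0 <->
  (forall i, i \notin s -> c i = 0) /\ forall j, \sum_i c i * (A i j)%:~R = x j.
Proof.
rewrite /constraint_mx mul_mx_row; split=> [/eq_row_mx [h1 h2]|[h1 h2]].
  split=> [i nis|j].
    move/rowP/(_ i): h2; rewrite mul_mx_diag !mxE nis mulr1; exact.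
  move/rowP/(_ j): h1; rewrite !mxE => <-.
  by apply: eq_bigr => i _; rewrite !mxE.
congr row_mx; apply/rowP => j.
  by rewrite !mxE -h2; apply: eq_bigr => i _; rewrite !mxE.
rewrite mul_mx_diag !mxE; have [/h1 ->|_] := boolP (j \notin s).
  by rewrite mul0r.
by rewrite mulr0.
Qed.

Let constraint_mx_ratr (F : numFieldType) :
  map_mx ratr (constraint_mx rat) = constraint_mx F.
Proof.
rewrite /constraint_mx map_row_mx; congr row_mx; apply/matrixP => i j.
  by rewrite !mxE ratr_int.
by rewrite !mxE rmorphMn /= ratr_nat.
Qed.

(** Membership in the row space of a rational matrix does not depend on the field. This brings real
    coordinates back to rational ones, whose denominators can be cleared. *)
Lemma rational_coords (F : numFieldType) (c : 'I_N -> F) (x : 'I_k -> int) :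
  (forall i, i \notin s -> c i = 0) ->
  (forall j, \sum_i c i * (A i j)%:~R = (x j)%:~R) ->
  exists c' : 'I_N -> rat, (forall i, i \notin s -> c' i = 0) /\
    forall j, \sum_i c' i * (A i j)%:~R = (x j)%:~R.
Proof.
move=> cs cx.
have /constraint_mxP := conj cs cx; rewrite -constraint_mx_ratr => e.
have : (map_mx (@ratr F) (row_mx (\row_j (x j)%:~R) 0 : 'rV[rat]_(k + N)) <=
        map_mx (@ratr F) (constraint_mx rat))%MS.
  apply/submxP; exists (\row_i c i); rewrite e map_row_mx map_mx0.
  by congr row_mx; apply/rowP => j; rewrite !mxE ratr_int.
rewrite map_submx => /submxP [D DE].
exists (fun i => D 0 i); apply/constraint_mxP.
by rewrite DE; congr (_ *m _); apply/rowP => i; rewrite mxE.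
Qed.

Lemma rational_indep (F : numFieldType) (c : 'I_N -> F) :
  (forall c' : 'I_N -> rat, (forall i, i \notin s -> c' i = 0) ->
    (forall j, \sum_i c' i * (A i j)%:~R = 0) -> forall i, c' i = 0) ->
  (forall i, i \notin s -> c i = 0) ->
  (forall j, \sum_i c i * (A i j)%:~R = 0) -> forall i, c i = 0.
Proof.
move=> H cs cA i.
have free : row_free (constraint_mx F).
  rewrite -constraint_mx_ratr /row_free mxrank_map -/(row_free _).
  apply/inj_row_free => D D0; apply/rowP => i'; rewrite mxE.
  have /constraint_mxP [h1 h2] :
      (\row_i D 0 i) *m constraint_mx rat = row_mx (\row_j 0) 0.
    have -> : (\row_i D 0 i) = D by apply/rowP => i1; rewrite mxE.
    rewrite D0 -row_mx0; congr row_mx; apply/rowP => j; by rewrite !mxE.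
  exact: H h1 h2 i'.
have /constraint_mxP e := conj cs cA.
have /(row_free_inj free) : (\row_i c i) *m constraint_mx F = 0 *m constraint_mx F.
  rewrite e mul0mx -row_mx0; congr row_mx; apply/rowP => j; by rewrite !mxE.
by move/rowP/(_ i); rewrite !mxE.
Qed.

End RationalCoordinates.

Section LinearProgram.
Variables (R : realFieldType) (N k : nat) (A : 'I_N -> 'I_k -> R) (w : 'I_N -> R).
Variables (p : 'I_k -> R) (j0 : 'I_k).
Hypothesis A_j0 : forall i, A i j0 = 1.

Definition feasible (t : {set 'I_N}) (la : 'I_N -> R) := [/\ forall i, 0 <= la i,
  forall i, i \notin t -> la i = 0 & forall j, \sum_i la i * A i j = p j].

Local Notation cost la := (\sum_i la i * w i).

Lemma feasible_sub (t t' : {set 'I_N}) la :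
  t \subset t' -> feasible t la -> feasible t' la.
Proof.
move=> /fintype.subsetP tt' [h1 h2 h3]; split=> // i it'; apply: h2.
by apply: contra it' => /tt'.
Qed.

(** A pivot: move along c until the first coefficient reaches 0. The column [j0] of ones forces the
    entries of c to sum to 0, so some entry is negative and the move is bounded. *)
Lemma feasible_shift (t : {set 'I_N}) la c : feasible t la ->
  (forall i, i \notin t -> c i = 0) -> (forall j, \sum_i c i * A i j = 0) ->
  (exists i, c i != 0) -> cost c <= 0 ->
  exists i la', [/\ i \in t, feasible (t :\ i) la' & cost la' <= cost la].
Proof.
move=> [la0 lat lap] ct cA [i1 ci1] cw.
have [i2 ci2] : exists i, c i < 0.
  apply: contrapT => nex.
  have c0 i : 0 <= c i by rewrite leNgt; apply/negP => ci; apply: nex; exists i.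
  have := cA j0; under eq_bigr do rewrite A_j0 mulr1.
  move/eqP; rewrite psumr_eq0 // => /allP /(_ i1 (mem_index_enum _)) /=.
  by rewrite (negbTE ci1).
case: (@arg_minP _ R _ i2 (fun i => c i < 0) (fun i => la i / - c i) ci2) => i ci imin.
pose th := la i / - c i.
have th0 : 0 <= th by rewrite divr_ge0 // oppr_ge0 ltW.
exists i, (fun l => la l + th * c l); split.
- by apply: contraTT ci => /ct ->; rewrite ltxx.
- split=> [l|l|j].
  + have [cl|cl] := ltP (c l) 0; last first.
      exact: addr_ge0 (la0 l) (mulr_ge0 th0 cl).
    have h : th <= la l / - c l := imin _ cl.
    by move: h; rewrite ler_pdivlMr ?oppr_gt0 //; lra.
  + rewrite in_setD1 negb_and negbK => /orP[/eqP ->|lt].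
      by rewrite /th; field; rewrite lt_eqF.
    by rewrite lat // ct // mulr0 addr0.
  + under eq_bigr do rewrite mulrDl -mulrA.
    by rewrite big_split /= -mulr_sumr cA mulr0 addr0 lap.
- under eq_bigr do rewrite mulrDl -mulrA.
  by rewrite big_split /= -mulr_sumr gerDl mulr_ge0_le0.
Qed.

(** Attainment by induction on the size of t. If the points over t are independent, there is only
    one feasible vector. Otherwise a relation of nonpositive cost moves every feasible vector to
    some [t :\ i] at no extra cost, so the best of the optima over these sets is optimal over t. *)
Lemma cost_min (t : {set 'I_N}) la0 : feasible t la0 ->
  exists2 la, feasible t la & forall la', feasible t la' -> cost la <= cost la'.
Proof.
have [m] := ubnP #|t|; elim: m t la0 => [//|m IHm] t la0 tm fla0.
have [[c [ct cA cn0]]|indep] := pselect (exists c : 'I_N -> R,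
    [/\ forall i, i \notin t -> c i = 0, forall j, \sum_i c i * A i j = 0
      & exists i, c i != 0]); last first.
  exists la0 => // la' fla'; rewrite le_eqVlt; apply/orP; left; apply/eqP.
  apply: eq_bigr => i _; congr (_ * _); apply/eqP; rewrite -subr_eq0.
  apply/negPn/negP => ne; apply: indep; exists (fun i => la0 i - la' i).
  case: fla0 fla' => _ h2 h3 [_ h2' h3']; split=> [l lt|j|]; last by exists i.
    by rewrite h2 // h2' // subrr.
  by under eq_bigr do rewrite mulrBl; rewrite sumrB h3 h3' subrr.
wlog cw : c ct cA cn0 / cost c <= 0.
  move=> H; have [|gt] := leP (cost c) 0; first exact: H.
  apply: (H (fun i => - c i)) => [i it|j||].
  - by rewrite ct // oppr0.
  - by under eq_bigr do rewrite mulNr; rewrite sumrN cA oppr0.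
  - by case: cn0 => i ci; exists i; rewrite oppr_eq0.
  - by under eq_bigr do rewrite mulNr; rewrite sumrN oppr_le0 ltW.
have shift la fla := @feasible_shift t la c fla ct cA cn0 cw.
have /choice [opt optP] : forall i, exists la, i \in t ->
    (exists la', feasible (t :\ i) la') ->
    feasible (t :\ i) la /\ forall la', feasible (t :\ i) la' -> cost la <= cost la'.
  move=> i; have [it|nit] := boolP (i \in t); last by exists la0.
  have [[la' fla']|nf] := pselect (exists la', feasible (t :\ i) la').
    have [|la fla lamin] := IHm _ la' _ fla'; last by exists la.
    by move: tm; rewrite (cardsD1 i) it.
  by exists la0 => _ /nf.
pose ok i := (i \in t) && `[< exists la', feasible (t :\ i) la' >].
have [i0 [la1 [i0t fla1 _]]] := shift _ fla0.
have ok0 : ok i0 by rewrite /ok i0t; apply/asboolP; exists la1.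
case: (@arg_minP _ R _ i0 ok (fun i => cost (opt i)) ok0) => i /andP[it /asboolP ei] imin.
have [fi _] := optP i it ei.
exists (opt i); first exact: feasible_sub (subsetDl _ _) fi.
move=> la' /shift [l [la2 [lt fla2 le]]].
have el : exists la', feasible (t :\ l) la' by exists la2.
have [_ /(_ _ fla2) h] := optP l lt el.
apply: le_trans le; apply: le_trans h; apply: imin.
by rewrite /ok lt; apply/asboolP.
Qed.

End LinearProgram.

Section StandardCover.
Variables (R : realFieldType) (n N : nat) (a : 'I_N -> 'rV[int]_n) (ord : rel 'X_{1..N}).
Hypothesis ordP : monomial_order ord.
Local Notation std := (standard a ord).
Hypothesis std_squarefree : forall u, std (mnm_ind (mnm_supp u)) -> std u.
Variable w : 'I_N -> int.
Hypothesis wP : forall u v, std u -> fiber a u v -> v <> u -> wdeg w u < wdeg w v.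
Local Notation A := (hcoord a).

Lemma hcoord_last i : A i (rshift n 0) = 1.
Proof. by rewrite /hcoord row_mxEr mxE. Qed.

Lemma standard_indep (s : {set 'I_N}) (c : 'I_N -> R) :
  std (mnm_ind s) -> (forall i, i \notin s -> c i = 0) ->
  (forall j, \sum_i c i * (A i j)%:~R = 0) -> forall i, c i = 0.
Proof.
move=> ss; apply: rational_indep => c' cs' cA i.
have [q [z [q0 cz]]] := common_denominator c'.
have qn0 : (q%:R : rat) != 0 by rewrite pnatr_eq0 -lt0n.
rewrite cz (standard_relation0 ordP std_squarefree wP ss) ?mul0r //.
  move=> j; apply/eqP; rewrite -(intr_eq0 rat) rmorph_sum /=.
  apply/eqP; transitivity (q%:R * \sum_l c' l * (A l j)%:~R).
    2: by rewrite cA mulr0.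
  rewrite mulr_sumr; apply: eq_bigr => l _; rewrite intrM cz; field; exact: qn0.
move=> l /cs' /eqP; rewrite cz mulf_eq0 invr_eq0 (negbTE qn0) orbF intr_eq0.
by move/eqP.
Qed.

Lemma lifting_functionR (s : {set 'I_N}) : std (mnm_ind s) ->
  exists y : 'I_(n + 1) -> R, forall i,
    if i \in s then \sum_j y j * (A i j)%:~R = (w i)%:~R
    else \sum_j y j * (A i j)%:~R < (w i)%:~R.
Proof.
move=> /(lifting_function ordP std_squarefree wP) [y Hy].
exists (fun j => ratr (y j)) => i.
have -> : \sum_j ratr (y j) * (A i j)%:~R =
    ratr (\sum_j y j * (A i j)%:~R) :> R.
  by rewrite rmorph_sum; apply: eq_bigr => j _ /=; rewrite rmorphM /= ratr_int.
have := Hy i; case: ifP => _; first by move=> ->; rewrite ratr_int.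
by move=> h; rewrite -[ltRHS]ratr_int ltr_rat.
Qed.

(** Rational coordinates exist by [rational_coords], are integral by [standard_unimodular], and
    agree with c by independence. *)
Lemma standard_coords (s : {set 'I_N}) (c : 'I_N -> R) (e : 'I_N -> int) :
  std (mnm_ind s) -> (forall i, i \notin s -> c i = 0) ->
  (forall j, \sum_i c i * (A i j)%:~R = (\sum_i e i * A i j)%:~R) ->
  exists r : 'I_N -> int, forall i, c i = (r i)%:~R.
Proof.
move=> ss cs ce.
have [c' [cs' ce']] := rational_coords cs ce.
have [q [z [q0 cz]]] := common_denominator c'.
have qn0 : (q%:R : rat) != 0 by rewrite pnatr_eq0 -lt0n.
have zs i : i \notin s -> z i = 0.
  move=> /cs' /eqP; rewrite cz mulf_eq0 invr_eq0 (negbTE qn0) orbF intr_eq0.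
  by move/eqP.
have eqz j : q%:Z * (\sum_i e i * A i j) = \sum_i z i * A i j.
  apply/eqP; rewrite -(eqr_int rat) intrM -ce' mulr_sumr rmorph_sum /=.
  by apply/eqP; apply: eq_bigr => i _; rewrite intrM cz -pmulrn; field.
have [r [rs zr]] := standard_unimodular ordP std_squarefree wP ss q0 zs eqz.
have er j : \sum_i e i * A i j = \sum_i r i * A i j.
  have qz : q%:Z != 0 by rewrite eqz_nat -lt0n.
  apply: (mulfI qz); rewrite eqz mulr_sumr.
  by apply: eq_bigr => i _; rewrite zr mulrA.
exists r => i; apply/eqP; rewrite -subr_eq0; apply/eqP.
apply: (standard_indep (c := fun i => c i - (r i)%:~R) ss) => [l ins|j].
  by rewrite cs // rs // subr0.
under eq_bigr do rewrite mulrBl; rewrite sumrB ce er rmorph_sum /=.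
apply/eqP; rewrite subr_eq0; apply/eqP/eq_bigr => l _.
by rewrite intrM.
Qed.

Local Notation AR := (fun i j => (A i j)%:~R : R).

(** The support s of a representation of minimal cost is standard: otherwise trading a small
    multiple of [mnm_ind s] for its normal form would lower the cost. *)
Lemma standard_cover p (la : 'I_N -> R) : feasible AR p [set: 'I_N]%SET la ->
  exists s la', std (mnm_ind s) /\ feasible AR p s la'.
Proof.
have A1 i : AR i (rshift n 0) = 1 by rewrite hcoord_last.
move=> /(cost_min (fun i => (w i)%:~R) A1) [{}la [la0 _ lap] lamin].
pose s := [set i | la i != 0]%SET.
have las i : i \notin s -> la i = 0 by rewrite inE negbK => /eqP.
exists s, la; split; last by [].
have [f fs stf] := standard_form a ordP (mnm_ind s).
apply: contrapT => Ns.
have sf : f <> mnm_ind s by move=> e; apply: Ns; rewrite -e.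
(* A positive number below every [la i] with i in s; the summand 1 covers the case of an empty s. *)
pose ep := (1 + \sum_(i in s) (la i)^-1)^-1.
have inv0 i : 0 <= (la i)^-1 by rewrite invr_ge0.
have ep0 : 0 < ep.
  by rewrite invr_gt0 ltr_pwDl // sumr_ge0.
have eple i : i \in s -> ep <= la i.
  move=> si; have li : 0 < la i by rewrite lt0r la0 andbT; move: si; rewrite inE.
  rewrite -[leRHS]invrK lef_pV2 ?posrE ?invr_gt0 //; last first.
    by rewrite ltr_pwDl // sumr_ge0.
  by rewrite (bigD1 i) //= addrCA lerDl addr_ge0 // sumr_ge0.
pose la' i := la i + ep * ((f i)%:R - (i \in s)%:R).
have sumE (g : 'I_N -> int) :
    \sum_i la' i * (g i)%:~R = \sum_i la i * (g i)%:~R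
      + ep * (wdeg g f - wdeg g (mnm_ind s))%:~R.
  rewrite intrB /wdeg !rmorph_sum -sumrB mulr_sumr -big_split.
  apply: eq_bigr => i _ /=.
  by rewrite -!(mulr_natl (g i)) !intrM !natz -!pmulrn mnm_indE /la'; ring.
have fla' : feasible AR p [set: 'I_N]%SET la'.
  split=> [i|i|j]; last 1 first.
  - by have /fiberP/(_ j) e := fs; rewrite sumE e subrr mulr0 addr0 lap.
  - have h : 0 <= ep * (f i)%:R by rewrite mulr_ge0 ?ler0n ?ltW.
    rewrite /la' mulrBr; have [si|nsi] := boolP (i \in s).
      by have := eple i si; rewrite mulr1; lra.
    by rewrite mulr0 subr0; exact: addr_ge0.
  - by rewrite inE.
have := lamin _ fla'; rewrite sumE lerDl pmulr_rge0 // ler0z subr_ge0 leNgt.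
by rewrite (wP stf (esym fs)) // => /esym.
Qed.

End StandardCover.

Local Open Scope classical_set_scope.

(** * Regular unimodular triangulations *)

Section Convexity.
Variables (R : realType) (n : nat).
Implicit Types (S : set 'rV[R]_n).

Lemma conv_fintype S (I : finType) (w : I -> R) (p : I -> 'rV[R]_n) :
  (forall i, 0 <= w i) -> \sum_i w i = 1 -> (forall i, S (p i)) ->
  conv S (\sum_i w i *: p i).
Proof.
move=> w0 w1 pS.
exists #|I|, (fun k => w (enum_val k)), (fun k => p (enum_val k)).
have bij : {on [pred _ | true], bijective (@enum_val I predT)}.
  exact/onW_bij/enum_val_bij.
split=> //; last by rewrite (reindex _ bij).
by rewrite -w1 [RHS](reindex _ bij).
Qed.

Lemma conv_convex S (I : finType) (w : I -> R) (p : I -> 'rV[R]_n) :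
  (forall i, 0 <= w i) -> \sum_i w i = 1 -> (forall i, conv S (p i)) ->
  conv S (\sum_i w i *: p i).
Proof.
move=> w0 w1 pS.
pose k i := projT1 (cid (pS i)); pose kP i := projT2 (cid (pS i)).
pose v i : 'I_(k i) -> R := projT1 (cid (kP i)); pose vP i := projT2 (cid (kP i)).
pose q i : 'I_(k i) -> 'rV[R]_n := projT1 (cid (vP i)).
have qP i : [/\ forall j, 0 <= v i j, \sum_j v i j = 1, forall j, S (q i j)
    & p i = \sum_j v i j *: q i j] := projT2 (cid (vP i)).
have -> : \sum_i w i *: p i =
    \sum_(t : {i : I & 'I_(k i)}) (w (tag t) * v (tag t) (tagged t)) *:
       q (tag t) (tagged t).
  rewrite -(sig_big_dep (fun=> true) (fun _ _ => true)
     (fun i j => (w i * v i j) *: q i j)) /=.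
  apply: eq_bigr => i _; have [_ _ _ ->] := qP i.
  by rewrite scaler_sumr; apply: eq_bigr => j _; rewrite scalerA.
apply: conv_fintype => [[i j]||[i j]] /=.
- by have [v0 _ _ _] := qP i; rewrite mulr_ge0.
- rewrite -(sig_big_dep (fun=> true) (fun _ _ => true) (fun i j => w i * v i j)).
  rewrite -[RHS]w1; apply: eq_bigr => i _; have [_ v1 _ _] := qP i.
  by rewrite -mulr_sumr v1 mulr1.
- by have [_ _ qS _] := qP i.
Qed.

Lemma conv_mono S S' : S `<=` S' -> conv S `<=` conv S'.
Proof. by move=> SS' x [k [w [p [h1 h2 h3 h4]]]]; exists k, w, p; split; auto. Qed.

Lemma sub_conv S : S `<=` conv S.
Proof.
move=> x Sx; exists 1%N, (fun=> 1), (fun=> x); split=> //.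
  by rewrite big_ord1.
by rewrite big_ord1 scale1r.
Qed.

Lemma conv_sub_conv S S' : S `<=` conv S' -> conv S `<=` conv S'.
Proof.
by move=> SS' x [k [w [p [w0 w1 pS ->]]]]; apply: conv_convex => // i; auto.
Qed.

(** Coefficients of equal indices are collected. Nonnegativity is kept conditional so that the lemma
    serves both [conv] and [aff_hull]. *)
Lemma combination_fintype (I : finType) (t : {set I}) (f : I -> 'rV[R]_n) k
    (w : 'I_k -> R) (p : 'I_k -> 'rV[R]_n) :
  (forall j, [set f i | i in [set` t]] (p j)) ->
  exists la : I -> R, [/\ (forall j, 0 <= w j) -> forall i, 0 <= la i,
    forall i, i \notin t -> la i = 0, \sum_i la i = \sum_j w j
    & \sum_j w j *: p j = \sum_i la i *: f i].
Proof.
move=> H; have /choice [g gP] : forall j, exists i, i \in t /\ f i = p j.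
  by move=> j; have [i it <-] := H j; exists i.
exists (fun i => \sum_(j | g j == i) w j); split.
- by move=> w0 i; apply: sumr_ge0.
- move=> i nit; rewrite big_pred0 // => j; apply: contraNF nit => /eqP <-.
  by have [] := gP j.
- by rewrite [RHS](partition_big g predT).
rewrite (partition_big g predT) //=; apply: eq_bigr => i _.
rewrite scaler_suml; apply: eq_bigr => j /eqP <-.
by have [_ ->] := gP j.
Qed.

Lemma conv_image (I : finType) (t : {set I}) (f : I -> 'rV[R]_n) x :
  conv [set f i | i in [set` t]] x <-> exists la : I -> R,
    [/\ forall i, 0 <= la i, forall i, i \notin t -> la i = 0, \sum_i la i = 1
      & x = \sum_i la i *: f i].
Proof.
split=> [[k [w [p [w0 w1 pS ->]]]]|[la [la0 lat la1 ->]]].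
  have [la [la0 lat la1 ->]] := combination_fintype w pS.
  by exists la; split=> //; [exact: la0|rewrite la1].
have [i0 i0t] : exists i, i \in t.
  apply: contrapT => nex; move/eqP: la1; rewrite big1 ?(eq_sym 0) ?oner_eq0 //.
  by move=> i _; apply: lat; apply/negP => it; apply: nex; exists i.
have -> : \sum_i la i *: f i = \sum_i la i *: (if i \in t then f i else f i0).
  apply: eq_bigr => i _; case: ifP => // /negbT /lat ->.
  by rewrite !scale0r.
apply: conv_fintype => // i; case: ifP => [it|_]; [by exists i|by exists i0].
Qed.

Lemma aff_hull_image (I : finType) (t : {set I}) (f : I -> 'rV[R]_n) x :
  aff_hull [set f i | i in [set` t]] x -> exists la : I -> R,
    [/\ forall i, i \notin t -> la i = 0, \sum_i la i = 1
      & x = \sum_i la i *: f i].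
Proof.
move=> [k [w [p [w1 pS ->]]]].
have [la [la0 lat la1 ->]] := combination_fintype w pS.
by exists la; split=> //; rewrite la1.
Qed.

End Convexity.

Lemma int_span_combination (V : zmodType) (I : finType) (t : {set I})
    (c : I -> V) (S : set V) x :
  (forall z, S z -> exists2 i, i \in t & z = c i) -> int_span S x ->
  exists e : I -> int, (forall i, i \notin t -> e i = 0) /\ \sum_i c i *~ e i = x.
Proof.
move=> Sc [s [sS ->]]; elim: s sS => [|[k u] s IHs] sS.
  by exists (fun=> 0); split=> //; rewrite big_nil big1 // => i _; rewrite mulr0z.
have [|e [et eE]] := IHs; first by move=> v vs; apply: sS; rewrite in_cons vs orbT.
have [i0 i0t /= ui0] := Sc _ (sS (k, u) (mem_head _ _)).
exists (fun i => (if i == i0 then k else 0) + e i); split=> [i it|].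
  by rewrite et // addr0; case: eqP it => // ->; rewrite i0t.
rewrite big_cons -eE; under eq_bigr do rewrite mulrzDr.
rewrite big_split /=; congr (_ + _); rewrite (bigD1 i0) //= eqxx big1 => [|i].
  by rewrite addr0 ui0.
by move/negbTE => ->; rewrite mulr0z.
Qed.

Lemma combination_int_span (V : zmodType) (I : finType) (c : I -> V) (S : set V)
    (e : I -> int) :
  (forall i, e i != 0 -> S (c i)) -> int_span S (\sum_i c i *~ e i).
Proof.
move=> Sc; exists [seq (e i, c i) | i <- enum I & e i != 0]; split.
  by move=> _ /mapP[i + ->]; rewrite mem_filter => /andP[ei _]; apply: Sc.
rewrite big_map big_filter [RHS]big_mkcond /= -[LHS]big_enum /=.
by apply: eq_bigr => i _; case: eqP => // ->; rewrite mulr0z.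
Qed.

Section HomogeneousCoordinates.
Variables (R : realType) (n N : nat) (a : 'I_N -> 'rV[int]_n).
Local Notation A := (hcoord a).

Lemma hcoordP (la : 'I_N -> R) (x : 'rV[R]_n) (h : R) :
  (\sum_i la i = h /\ \sum_i la i *: int_vec R (a i) = x) <->
  forall j, \sum_i la i * (A i j)%:~R = row_mx x (const_mx h : 'rV_1) 0 j.
Proof.
split=> [[<- <-] j|H].
  case: (split_ordP j) => l ->.
    rewrite row_mxEl summxE; apply: eq_bigr => i _.
    by rewrite /hcoord row_mxEl !mxE.
  rewrite row_mxEr mxE; apply: eq_bigr => i _.
  by rewrite /hcoord row_mxEr mxE mulr1.
split.
  have := H (rshift n 0); rewrite row_mxEr mxE => <-.
  by apply: eq_bigr => i _; rewrite hcoord_last mulr1.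
apply/rowP => l; have := H (lshift 1 l); rewrite row_mxEl => <-.
rewrite summxE; apply: eq_bigr => i _.
by rewrite /hcoord row_mxEl !mxE.
Qed.

Lemma hcoordP_int (r : 'I_N -> int) (x : 'rV[int]_n) (h : int) :
  (\sum_i r i = h /\ \sum_i a i *~ r i = x) <->
  forall j, \sum_i r i * A i j = row_mx x (const_mx h : 'rV_1) 0 j.
Proof.
have zE i l : (a i *~ r i) 0 l = r i * a i 0 l.
  by rewrite -scaler_int mxE intz.
split=> [[<- <-] j|H].
  case: (split_ordP j) => l ->.
    rewrite row_mxEl summxE; apply: eq_bigr => i _.
    by rewrite /hcoord row_mxEl zE.
  rewrite row_mxEr mxE; apply: eq_bigr => i _.
  by rewrite /hcoord row_mxEr mxE mulr1.
split.
  have := H (rshift n 0); rewrite row_mxEr mxE => <-.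
  by apply: eq_bigr => i _; rewrite hcoord_last mulr1.
apply/rowP => l; have := H (lshift 1 l); rewrite row_mxEl => <-.
rewrite summxE; apply: eq_bigr => i _.
by rewrite zE /hcoord row_mxEl.
Qed.

End HomogeneousCoordinates.

Section Triangulation.
Variables (R : realType) (n N : nat) (P : set 'rV[R]_n) (a : 'I_N -> 'rV[int]_n).
Hypothesis a_inj : injective a.
Hypothesis a_latt : lattice_points P = range a.
Hypothesis P_conv : P = conv [set int_vec R z | z in lattice_points P].
Variable ord : rel 'X_{1..N}.
Hypothesis ordP : monomial_order ord.
Local Notation std := (standard a ord).
Hypothesis std_squarefree : forall u, std (mnm_ind (mnm_supp u)) -> std u.
Hypothesis P_span : lattice_spanning P.
Local Notation A := (hcoord a).
Local Notation ha x h := (row_mx x (const_mx h : 'rV_1)).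
Local Notation AR := (fun i j => (A i j)%:~R : R).

Lemma P_combination (x : 'rV[R]_n) : P x <-> exists la : 'I_N -> R,
  [/\ forall i, 0 <= la i, \sum_i la i = 1 & x = \sum_i la i *: int_vec R (a i)].
Proof.
have imE : [set int_vec R z | z in lattice_points P] =
    [set int_vec R (a i) | i in [set` [set: 'I_N]%SET]].
  rewrite a_latt; apply/seteqP; split => [_ [_ [i _ <-] <-]|_ [i _ <-]].
    by exists i => //=; rewrite inE.
  by exists (a i) => //; exists i.
rewrite P_conv imE; split=> [/conv_image [la [h1 _ h2 h3]]|[la [h1 h2 h3]]].
  by exists la.
by apply/conv_image; exists la; split=> // i; rewrite inE.
Qed.

Lemma P_lattice i : P (int_vec R (a i)).
Proof. by have : range a (a i) by []; rewrite -a_latt. Qed.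

Lemma P_convex (la : 'I_N -> R) : (forall i, 0 <= la i) -> \sum_i la i = 1 ->
  P (\sum_i la i *: int_vec R (a i)).
Proof. by move=> la0 la1; apply/P_combination; exists la. Qed.

Lemma span_coords (x : 'rV[int]_(n + 1)) :
  exists e : 'I_N -> int, forall j, \sum_i e i * A i j = x 0 j.
Proof.
have : [set: 'rV[int]_(n + 1)] x by [].
rewrite -P_span => /(int_span_combination (t := [set: 'I_N]%SET)
  (c := fun i => homogenize (a i))) [z|e [_ <-]].
  by rewrite a_latt => -[_ [i _ <-] <-]; exists i; rewrite ?inE.
exists e => j; rewrite summxE; apply: eq_bigr => i _.
by rewrite -scaler_int mxE intz.
Qed.

Lemma dilate_feasible k (x : 'rV[R]_n) : dilate k P x ->
  exists la, feasible AR (fun j => ha x k%:R 0 j) [set: 'I_N]%SET la.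
Proof.
move=> [_ /P_combination [la [la0 la1 ->]] <-].
exists (fun i => k%:R * la i); split=> [i|i|].
- by rewrite mulr_ge0.
- by rewrite inE.
apply/hcoordP; split; first by rewrite -mulr_sumr la1 mulr1.
by rewrite scaler_sumr; apply: eq_bigr => i _; rewrite scalerA.
Qed.

Lemma dilate_monomial k u (x : 'rV[int]_n) : (0 < k)%N ->
  expo a u = ha x k%:Z -> dilate k P (int_vec R x).
Proof.
move=> k0 ux; have kn0 : (k%:R : R) != 0 by rewrite pnatr_eq0 -lt0n.
have /hcoordP_int [h1 h2] : forall j, \sum_i (u i)%:Z * A i j = ha x k%:Z 0 j.
  move=> j; rewrite -ux expo_hcoord; apply: eq_bigr => i _.
  by rewrite -(mulr_natl (A i j)) natz.
have h1R : \sum_i (u i)%:R = k%:R :> R.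
  have /(congr1 (fun z : int => z%:~R : R)) := h1; rewrite rmorph_sum /= => E.
  exact: E.
exists (\sum_i ((u i)%:R / k%:R) *: int_vec R (a i)).
  apply: P_convex => [i|]; first by rewrite divr_ge0.
  by rewrite -mulr_suml h1R divff.
rewrite scaler_sumr -h2; apply/rowP => j; rewrite summxE mxE summxE rmorph_sum /=.
apply: eq_bigr => i _; rewrite !mxE mulrA mulrC -scaler_int mxE intz intrM.
by rewrite mulrC; congr (_ * _); rewrite mulrCA divff ?mulr1.
Qed.

Lemma weight_exists : exists w : 'I_N -> int, forall u v,
  std u -> fiber a u v -> v <> u -> wdeg w u < wdeg w v.
Proof. exact: (standard_weight ordP std_squarefree). Qed.

(** [standard_cover] represents (x, k) with nonnegative coefficients on a standard support, where
    [standard_coords] makes them integers: they are the exponents of a monomial. *)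
Lemma normality k (x : 'rV[int]_n) : lattice_points (dilate k P) x ->
  exists u, expo a u = ha x k%:Z.
Proof.
move=> /dilate_feasible [la fla]; have [w wP] := weight_exists.
have {fla} [s [{}la [ss [la0 las laE]]]] := standard_cover ordP wP fla.
have [e eE] := span_coords (ha x k%:Z).
have haE j : ha (int_vec R x) k%:R 0 j = (ha x k%:Z 0 j)%:~R.
  case: (split_ordP j) => l ->; first by rewrite !row_mxEl mxE.
  by rewrite !row_mxEr !mxE.
have [j|r rE] := standard_coords (e := e) ordP std_squarefree wP ss las.
  by rewrite laE eE haE.
have r0 i : 0 <= r i by rewrite -(ler0z R) -rE.
exists [multinom `|r i|%N | i < N]; apply/rowP => j; rewrite expo_hcoord.
apply/eqP; rewrite -(eqr_int R) -haE -laE; apply/eqP.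
rewrite /wdeg rmorph_sum; apply: eq_bigr => i _ /=.
by rewrite mnmE -(mulr_natl (A i j)) intrM natz gez0_abs // rE.
Qed.

(** Any variable of a monomial of degree k + 1 over x splits off a lattice point of P. *)
Lemma IDP_of_squarefree : IDP P.
Proof.
move=> k k1; apply/seteqP; split=> x.
  move=> [z Pz [t /= kPt <-]].
  have [u1 e1] : exists u, expo a u = ha z 1.
    by move: Pz; rewrite /= a_latt => -[i _ <-]; exists U_(i)%MM; rewrite expo1.
  have [u2 e2] := normality kPt.
  apply: (@dilate_monomial _ (u1 + u2)%MM) => //.
  rewrite expoD e1 e2 add_row_mx; congr row_mx; apply/rowP => j.
  by rewrite !mxE -PoszD add1n.
move=> /normality [u ux].
have [i ui] : exists i, u i != 0%N.
  apply: contrapT => nex; have := expo_mdeg a u; rewrite ux row_mxEr mxE mdegE.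
  rewrite big1 // => i _; apply/eqP/negPn/negP => ui; apply: nex; by exists i.
have ule : (U_(i) <= u)%MM by rewrite lep1mP.
exists (a i); first exact: P_lattice.
exists (x - a i); last by rewrite addrC subrK.
apply: (@dilate_monomial _ (u - U_(i))%MM) => //.
have : expo a (u - U_(i))%MM + expo a U_(i)%MM = expo a u by rewrite -expoD submK.
rewrite ux expo1 => /esym/eqP; rewrite -subr_eq => /eqP <-.
rewrite /homogenize opp_row_mx add_row_mx; congr row_mx; apply/rowP => j.
by rewrite !mxE intS addrAC subrr add0r.
Qed.

Definition simplex (s : {set 'I_N}) : {fset 'rV[int]_n} := [fset a i | i in s]%fset.

Definition cells : set {fset 'rV[int]_n} :=
  [set S | exists2 s, std (mnm_ind s) & S = simplex s].

Lemma in_simplex s i : (a i \in simplex s) = (i \in s).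
Proof.
apply/imfsetP/idP => [[l /= ls /a_inj ->] //|si]; by exists i.
Qed.

Lemma simplexP s z : z \in simplex s -> exists2 i, i \in s & z = a i.
Proof. by move/imfsetP => [i /= si ->]; exists i. Qed.

Lemma simplex_sub (S : {fset 'rV[int]_n}) :
  [set` S] `<=` lattice_points P -> S = simplex [set i | a i \in S]%SET.
Proof.
move=> SP; apply/fsetP => z; apply/idP/idP => [zS|/simplexP [i]].
  by have := SP z zS; rewrite a_latt => -[i _ iz]; rewrite -iz in_simplex inE iz.
by rewrite inE => iS ->.
Qed.

Lemma sum_simplex (V : nmodType) s (F : 'rV[int]_n -> V) :
  \sum_(z <- simplex s) F z = \sum_(i in s) F (a i).
Proof.
rewrite big_imfset /=; last by move=> x y _ _; apply: a_inj.
by rewrite -big_enum /=; apply/perm_big/uniq_perm; rewrite ?enum_finmem_uniq ?enum_uniq.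
Qed.

Lemma real_points_simplex s :
  @real_points R n (simplex s) = [set int_vec R (a i) | i in [set` s]].
Proof.
apply/seteqP; split=> [_ [z /simplexP [i si ->] <-]|_ [i si <-]].
  by exists i.
by exists (a i) => //=; rewrite in_simplex.
Qed.

Lemma simplex_affinely_independent s :
  std (mnm_ind s) -> affinely_independent R (simplex s).
Proof.
have [w wP] := weight_exists.
move=> ss c; rewrite !sum_simplex => c1 c2 _ /simplexP [i si ->].
pose la i := if i \in s then c (a i) else 0.
have la0 : forall j, \sum_i la i * (A i j)%:~R = 0.
  have /hcoordP H : \sum_i la i = 0 /\ \sum_i la i *: int_vec R (a i) = 0.
    rewrite big_mkcond /= in c1; rewrite big_mkcond /= in c2; split=> //.
    rewrite -[RHS]c2; apply: eq_bigr => l _; rewrite /la.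
    by case: ifP; rewrite ?scale0r.
  by move=> j; rewrite H; case: (split_ordP j) => l ->;
    rewrite ?row_mxEl ?row_mxEr mxE.
have las l : l \notin s -> la l = 0 by rewrite /la => /negbTE ->.
by have := standard_indep ordP std_squarefree wP ss las la0 i; rewrite /la si.
Qed.

Lemma simplex_unimodular s : std (mnm_ind s) -> unimodular R (simplex s).
Proof.
have [w wP] := weight_exists.
move=> ss; split=> [|z]; first exact: simplex_affinely_independent.
rewrite real_points_simplex => /aff_hull_image [la [las la1 zE]].
have [e eE] := span_coords (ha z 1).
have haE j : ha (int_vec R z) 1 0 j = (ha z 1 0 j)%:~R.
  case: (split_ordP j) => l ->; first by rewrite !row_mxEl mxE.
  by rewrite !row_mxEr !mxE.
have /hcoordP laE := conj la1 (esym zE).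
have [j|r rE] := standard_coords (e := e) ordP std_squarefree wP ss las.
  by rewrite laE eE haE.
have /hcoordP_int [r1 r2] : forall j, \sum_i r i * A i j = ha z 1 0 j.
  move=> j; apply/eqP; rewrite -(eqr_int R) -haE -laE rmorph_sum /=; apply/eqP.
  by apply: eq_bigr => i _; rewrite intrM rE.
have rs i : i \notin s -> r i = 0.
  by move=> /las /eqP; rewrite rE intr_eq0 => /eqP.
have [c cE] : exists c : 'rV[int]_n -> int, forall i, c (a i) = r i.
  exists (fun z => if [pick i | a i == z] is Some i then r i else 0) => i.
  by case: pickP => [l /eqP /a_inj -> //|/(_ i)]; rewrite eqxx.
exists c; rewrite !sum_simplex -r1 -[LHS in _ /\ LHS = _]r2; split.
  rewrite [RHS](bigID (mem s)) /= [X in _ + X]big1 ?addr0; last exact: rs.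
  by apply: eq_bigr => i _.
rewrite [LHS](bigID (mem s)) /= [X in _ + X]big1 ?addr0.
  by apply: eq_bigr => i _; rewrite cE.
by move=> i /rs ->; rewrite mulr0z.
Qed.

Lemma simplex_lattice s : [set` simplex s] `<=` lattice_points P.
Proof. by move=> _ /simplexP [i _ ->]; apply: P_lattice. Qed.

(* The lifting function of s bounds the weight from below, with equality on s
   only; comparing those of s and t at a common point shows that the two
   barycentric representations have the same weight. *)
Lemma simplexI s t : std (mnm_ind s) -> std (mnm_ind t) ->
  conv (@real_points R n (simplex s)) `&` conv (@real_points R n (simplex t)) =
  conv (@real_points R n (simplex s `&` simplex t)%fset).
Proof.
have [w wP] := weight_exists.
move=> ss st.
have -> : (simplex s `&` simplex t)%fset = simplex (s :&: t)%SET.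
  apply/fsetP => z; rewrite inE; apply/andP/idP.
    by move=> [/simplexP [i si ->]]; rewrite !in_simplex inE si.
  by move/simplexP => [i + ->]; rewrite !in_simplex inE => /andP.
rewrite !real_points_simplex; apply/seteqP; split=> x; last first.
  by move=> xst; split; move: xst; apply: conv_mono => y [i /=];
    rewrite inE => /andP[si ti] <-; exists i.
case=> /conv_image [la [la0 las la1 xla]] /conv_image [mu [mu0 mut mu1 xmu]].
apply/conv_image; exists mu; split=> // i.
rewrite inE negb_and => /orP[ins|]; last exact: mut.
have /hcoordP laE := conj la1 (esym xla); have /hcoordP muE := conj mu1 (esym xmu).
have [y yP] := lifting_functionR R ordP std_squarefree wP ss.
have [y' y'P] := lifting_functionR R ordP std_squarefree wP st.
pose L (y : 'I_(n + 1) -> R) := \sum_j y j * ha x 1 0 j.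
have LE (y0 : 'I_(n + 1) -> R) (nu : 'I_N -> R) :
    (forall j, \sum_i nu i * (A i j)%:~R = ha x 1 0 j) ->
    \sum_i nu i * \sum_j y0 j * (A i j)%:~R = L y0.
  move=> nuE; rewrite /L; under [RHS]eq_bigr do rewrite -nuE mulr_sumr.
  rewrite exchange_big; apply: eq_bigr => k _; rewrite mulr_sumr.
  by apply: eq_bigr => j _; rewrite mulrCA.
have law : \sum_i la i * (w i)%:~R = L y.
  rewrite -(LE y la) //; apply: eq_bigr => k _.
  have [ks|/las ->] := boolP (k \in s); last by rewrite !mul0r.
  by have := yP k; rewrite ks => ->.
have muw : \sum_i mu i * (w i)%:~R = L y'.
  rewrite -(LE y' mu) //; apply: eq_bigr => k _.
  have [ks|/mut ->] := boolP (k \in t); last by rewrite !mul0r.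
  by have := y'P k; rewrite ks => ->.
have Ly'y : L y' <= L y.
  rewrite -law -(LE y' la) //; apply: ler_sum => k _; apply: ler_wpM2l => //.
  by have := y'P k; case: ifP => _ => [->//|/ltW].
(* The terms are nonnegative with sum at most 0, so all vanish; off s the second factor is positive,
   which forces mu to vanish there. *)
pose gap k := mu k * ((w k)%:~R - \sum_j y j * (A k j)%:~R).
have gap0 k : 0 <= gap k.
  apply: mulr_ge0 => //; rewrite subr_ge0.
  by have := yP k; case: ifP => _ => [->//|/ltW].
have : \sum_k gap k <= 0.
  under eq_bigr do rewrite /gap mulrBr.
  by rewrite sumrB muw (LE y mu) // subr_le0.
move=> gle; have /eqP : \sum_k gap k = 0.
  by apply/eqP; rewrite eq_le gle sumr_ge0.
rewrite psumr_eq0 // => /allP /(_ i (mem_index_enum _)) /=.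
rewrite /gap mulf_eq0 => /orP[/eqP //|].
by have := yP i; rewrite (negbTE ins) => lt; rewrite subr_eq0 gt_eqF.
Qed.

Lemma cells_triangulation : triangulation P cells.
Proof.
have [w wP] := weight_exists.
split.
- move=> _ [s ss ->]; split; first exact: simplex_lattice.
  exact: simplex_affinely_independent.
- move=> _ t [s ss ->] ts.
  have tP : [set` t] `<=` lattice_points P.
    by move=> z zt; apply: (@simplex_lattice s); apply: (fsubsetP ts).
  exists [set i | a i \in t]%SET; last exact: simplex_sub.
  apply: (standard_sub ordP std_squarefree) ss.
  apply/fintype.subsetP => i; rewrite inE => /(fsubsetP ts).
  by rewrite in_simplex.
- by move=> _ _ [s ss ->] [t st ->]; apply: simplexI.
apply/seteqP; split=> x.
  move=> [_ [s ss ->]]; rewrite real_points_simplex => /conv_image.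
  by move=> [la [la0 _ la1 ->]]; apply: P_convex.
move=> /P_combination [la [la0 la1 xE]].
have /hcoordP laE := conj la1 (esym xE).
have fla : feasible AR (fun j => ha x 1 0 j) [set: 'I_N]%SET la.
  by split=> // i; rewrite inE.
have [s [mu [ss [mu0 mus /hcoordP [mu1 muE]]]]] := standard_cover ordP wP fla.
exists (simplex s); first by exists s.
by rewrite real_points_simplex; apply/conv_image; exists mu; split.
Qed.

(** Cells have lifting functions. Conversely, an affine function that touches w exactly on s takes
    the same total on [mnm_ind s] and on its standard form, so the latter cannot be lighter and
    equals [mnm_ind s]. *)
Lemma cells_regular : regular P cells.
Proof.
have [w wP] := weight_exists.
have [wR wRE] : exists wR : 'rV[int]_n -> R, forall i, wR (a i) = (w i)%:~R.
  exists (fun z => if [pick i | a i == z] is Some i then (w i)%:~R else 0) => i.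
  by case: pickP => [l /eqP /a_inj -> //|/(_ i)]; rewrite eqxx.
have affE (c : 'cV[R]_n) c0 i :
    (int_vec R (a i) *m c) 0 0 + c0 =
    \sum_j (col_mx c (const_mx c0 : 'cV_1)) j 0 * (A i j)%:~R.
  rewrite big_split_ord big_ord1 /= /hcoord row_mxEr col_mxEd !mxE mulr1.
  congr (_ + _); apply: eq_bigr => j _.
  by rewrite col_mxEu row_mxEl !mxE mulrC.
exists wR => S; split=> [[s ss ->]|[SP [c [c0 H]]]].
  split; first exact: simplex_lattice.
  have [y yP] := lifting_functionR R ordP std_squarefree wP ss.
  exists (\col_j y (lshift 1 j)), (y (rshift n 0)) => z.
  rewrite a_latt => -[i _ <-]; rewrite in_simplex affE wRE.
  have -> : \sum_j col_mx (\col_j y (lshift 1 j)) (const_mx (y (rshift n 0)) : 'cV_1) j 0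
      * (A i j)%:~R = \sum_j y j * (A i j)%:~R.
    apply: eq_bigr => j _; case: (split_ordP j) => l ->.
      by rewrite col_mxEu mxE.
    by rewrite col_mxEd mxE (ord1 l).
  exact: yP.
rewrite (simplex_sub SP); set s := [set i | a i \in S]%SET; exists s => //.
pose y j := (col_mx c (const_mx c0 : 'cV_1)) j 0.
have yP i : if i \in s then \sum_j y j * (A i j)%:~R = (w i)%:~R
    else \sum_j y j * (A i j)%:~R < (w i)%:~R.
  by have := H _ (P_lattice i); rewrite affE wRE inE.
have [v sv stv] := standard_form a ordP (mnm_ind s).
have [-> //|ne] := pselect (mnm_ind s = v).
have := wP _ _ stv (esym sv) ne.
have wE u : (wdeg w u)%:~R = \sum_i (u i)%:R * (w i)%:~R :> R.
  rewrite /wdeg rmorph_sum; apply: eq_bigr => i _ /=.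
  by rewrite -(mulr_natl (w i)) intrM natz -pmulrn.
have LE (u : 'X_{1..N}) : \sum_i (u i)%:R * (\sum_j y j * (A i j)%:~R) =
    \sum_j y j * (expo a u 0 j)%:~R.
  under [RHS]eq_bigr do rewrite expo_hcoord /wdeg rmorph_sum mulr_sumr.
  rewrite exchange_big; apply: eq_bigr => i _; rewrite mulr_sumr.
  by apply: eq_bigr => j _ /=; rewrite -(mulr_natl (A i j)) intrM natz -pmulrn; ring.
rewrite -(ltr_int R) ltNge => /negP []; rewrite !wE.
have -> : \sum_i (mnm_ind s i)%:R * (w i)%:~R =
    \sum_i (v i)%:R * (\sum_j y j * (A i j)%:~R) :> R.
  rewrite LE -sv -LE; apply: eq_bigr => i _; rewrite mnm_indE.
  by have := yP i; case: ifP => _ => [->//|]; rewrite !mul0r.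
apply: ler_sum => i _; apply: ler_wpM2l => //.
by have := yP i; case: ifP => _ => [->//|/ltW].
Qed.

Lemma regular_unimodular_of_squarefree : has_regular_unimodular_triangulation P.
Proof.
exists cells; split; [exact: cells_triangulation|exact: cells_regular|].
by move=> _ [s ss ->]; apply: simplex_unimodular.
Qed.

End Triangulation.

(** * Cayley sums *)

Lemma lattice_polytope_conv (R : realType) (n : nat) (Q : set 'rV[R]_n) :
  lattice_polytope Q -> Q = conv [set int_vec R z | z in lattice_points Q].
Proof.
move=> [V QV]; apply/seteqP; split; last first.
  by rewrite [X in _ `<=` X]QV; apply: conv_sub_conv => _ [z Qz <-]; rewrite -QV.
rewrite [X in X `<=` _]QV; apply: conv_mono => _ [z zV <-]; exists z => //.
by rewrite /lattice_points /= QV; apply: sub_conv; exists z.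
Qed.

Section CayleyLattice.
Variables (R : realType) (d m : nat) (P : 'I_m -> set 'rV[R]_d).
Hypothesis m_gt0 : (0 < m)%N.
Hypothesis P_lattice : forall i, lattice_polytope (P i).

Definition cay_int (i : 'I_m) : 'rV[int]_(m.-1) := \row_j (j == i :> nat)%:R.

Lemma int_vec_cay i : int_vec R (cay_int i) = cayley_vec R i.
Proof. by apply/rowP => j; rewrite !mxE; case: eqP. Qed.

Lemma cayley_lattice i p : lattice_points (P i) p ->
  lattice_points (cayley_sum P) (row_mx p (cay_int i)).
Proof.
move=> Pp; apply: sub_conv; exists i => //; exists (int_vec R p) => //.
by rewrite /int_vec map_row_mx -/(int_vec R (cay_int i)) int_vec_cay.
Qed.

Lemma ord_split (j : 'I_m) :
  (exists l : 'I_m.-1, j = widen_ord (leq_pred m) l) \/ (j = m.-1 :> nat).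
Proof.
have [lt|ge] := ltnP j m.-1; first by left; exists (Ordinal lt); apply/val_inj.
by right; apply/eqP; rewrite eqn_leq ge -ltnS prednK // ltn_ord.
Qed.

Lemma cay_int_inj : injective cay_int.
Proof.
have eqw (l : 'I_m.-1) j : cay_int (widen_ord (leq_pred m) l) = cay_int j ->
    widen_ord (leq_pred m) l = j.
  move=> /rowP /(_ l); rewrite !mxE eqxx => /esym/eqP.
  by rewrite pnatr_eq1 eqb1 => /eqP e; apply/val_inj.
move=> i j e; have [[l il]|il] := ord_split i; first by rewrite il; apply: eqw; rewrite -il.
have [[l jl]|jl] := ord_split j; last by apply/val_inj; rewrite /= il jl.
by rewrite jl; apply/esym/eqw; rewrite -jl.
Qed.

Lemma cayley_polytope :
  cayley_sum P = conv [set int_vec R z | z in lattice_points (cayley_sum P)].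
Proof.
apply/seteqP; split; last by apply: conv_sub_conv => _ [z Cz <-].
apply: conv_sub_conv => _ [i _ [x + <-]].
rewrite (lattice_polytope_conv (P_lattice i)) => -[k [w [p [w0 w1 pP ->]]]].
have -> : row_mx (\sum_j w j *: p j) (cayley_vec R i) =
    \sum_j w j *: row_mx (p j) (cayley_vec R i).
  apply/rowP => l; rewrite summxE; case: (split_ordP l) => l' ->.
    by rewrite row_mxEl summxE; apply: eq_bigr => j _;
      rewrite [LHS]mxE [RHS]mxE row_mxEl.
  rewrite row_mxEr -[LHS]mul1r -w1 mulr_suml.
  by apply: eq_bigr => j _; rewrite [RHS]mxE row_mxEr.
apply: conv_fintype => // j; have [z Pz <-] := pP j.
exists (row_mx z (cay_int i)); first exact: cayley_lattice.
by rewrite /int_vec map_row_mx -/(int_vec R (cay_int i)) int_vec_cay.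
Qed.

(** The total weight [mu i] carried by the i-th summand is, except for the last i, a coordinate of z
    and so an integer. As the [mu i] are nonnegative with sum 1, a single summand carries all the
    weight. *)
Lemma cayley_latticeP z : lattice_points (cayley_sum P) z ->
  exists i p, lattice_points (P i) p /\ z = row_mx p (cay_int i).
Proof.
rewrite /lattice_points /= => -[k [w [q [w0 w1 qS zE]]]].
have /choice [ix ixP] : forall l, exists ix : 'I_m * 'rV[R]_d,
    P ix.1 ix.2 /\ q l = row_mx ix.2 (cayley_vec R ix.1).
  by move=> l; have [i _ [x Px <-]] := qS l; exists (i, x).
pose mu i := \sum_(l | (ix l).1 == i) w l.
have mu0 i : 0 <= mu i by apply: sumr_ge0.
have mu1 : \sum_i mu i = 1.
  by rewrite -w1 [RHS](partition_big (fun l => (ix l).1) predT).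
have mule i : mu i <= 1 by rewrite -mu1 (bigD1 i) //= lerDl sumr_ge0.
have muE (l : 'I_m.-1) : mu (widen_ord (leq_pred m) l) = (z 0 (rshift d l))%:~R.
  have := congr1 (fun x : 'rV_(d + m.-1) => x 0 (rshift d l)) zE.
  rewrite mxE => ->; rewrite summxE /mu big_mkcond /=; apply: eq_bigr => l' _.
  have [_ ->] := ixP l'; rewrite mxE row_mxEr mxE -val_eqE /= eq_sym.
  by case: eqP => _; rewrite ?mulr1 ?mulr0.
have [i0 mui0] : exists i, mu i = 1.
  have [[l nz]|allz] := pselect (exists l : 'I_m.-1, z 0 (rshift d l) != 0).
    exists (widen_ord (leq_pred m) l); apply/eqP; rewrite eq_le mule muE /=.
    have := mu0 (widen_ord (leq_pred m) l); rewrite muE ler0z ler1z => h.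
    by rewrite -gtz0_ge1 lt_neqAle eq_sym nz.
  have lastP : (m.-1 < m)%N by rewrite prednK.
  exists (Ordinal lastP); rewrite -mu1 (bigD1 (Ordinal lastP)) //= big1 ?addr0 //.
  move=> i; have [[l ->] _|e] := ord_split i; last by rewrite -val_eqE /= e eqxx.
  rewrite muE; have [-> //|/eqP nz] := eqVneq (z 0 (rshift d l)) 0.
  by case: allz; exists l; apply/eqP.
have wz l : (ix l).1 != i0 -> w l = 0.
  move=> ne; have : mu (ix l).1 = 0.
    apply/eqP; rewrite eq_le mu0 andbT.
    have := mu1; rewrite (bigD1 i0) //= mui0 (bigD1 (ix l).1) //= => e.
    have h : 0 <= \sum_(i < m | (i != i0) && (i != (ix l).1)) mu i by apply: sumr_ge0.
    lra.
  by move/eqP; rewrite psumr_eq0 // => /allP /(_ l (mem_index_enum _)); rewrite eqxx => /eqP.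
exists i0, (lsubmx z); split; last first.
  rewrite -[LHS]hsubmxK; congr row_mx; apply/rowP => j.
  apply/eqP; rewrite -(eqr_int R) mxE -muE mxE; apply/eqP.
  have [e|ne] := eqVneq (widen_ord (leq_pred m) j) i0.
    by rewrite e mui0 -e /= eqxx.
  rewrite -val_eqE /= in ne; rewrite (negbTE ne) /mu big1 // => l.
  by move/eqP => e; apply: wz; rewrite e -val_eqE.
have [l0 el0] : exists l, (ix l).1 == i0.
  apply: contrapT => nex; move/eqP: mui0; rewrite /mu big_pred0 ?(eq_sym 0) ?oner_eq0 //.
  by move=> l; apply/negP => e; apply: nex; exists l.
have -> : int_vec R (lsubmx z) =
    \sum_l w l *: (if (ix l).1 == i0 then (ix l).2 else (ix l0).2).
  have -> : int_vec R (lsubmx z) = lsubmx (int_vec R z).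
    by apply/rowP => j; rewrite !mxE.
  rewrite zE; apply/rowP => j; rewrite mxE !summxE; apply: eq_bigr => l _.
  rewrite !mxE; have [_ ->] := ixP l; rewrite row_mxEl.
  by case: ifP => // /negbT /wz ->; rewrite !mul0r.
rewrite (lattice_polytope_conv (P_lattice i0)); apply: conv_convex => // l.
rewrite -lattice_polytope_conv //; case: eqP => [<-|_]; first by case: (ixP l).
by rewrite -(eqP el0); case: (ixP l0).
Qed.

End CayleyLattice.

(** * Minkowski sums *)

Section DiagonalConfiguration.
Variables (n N d m : nat) (a : 'I_N -> 'rV[int]_n).
(* a i is the point of the Cayley sum given by pt i in the summand g i. *)
Variables (g : 'I_N -> 'I_m) (pt : 'I_N -> 'rV[int]_d).
Hypothesis m_gt0 : (0 < m)%N.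
Hypothesis a_inj : injective a.

Definition gdeg (j : 'I_m) (u : 'X_{1..N}) : nat := \sum_(i | g i == j) u i.
Definition ptsum (u : 'X_{1..N}) : 'rV[int]_d := \sum_i pt i *+ u i.

Hypothesis fiberE : forall u v,
  fiber a u v <-> ptsum u = ptsum v /\ forall j, gdeg j u = gdeg j v.

Variables (ord : rel 'X_{1..N}) (G : set 'X_{1..N}) (l : nat).
Hypothesis ordP : monomial_order ord.
Hypothesis G_squarefree : forall u, G u -> (forall i, (u i <= 1)%N) /\ (mdeg u <= l)%N.
Local Notation std := (standard a ord).
Hypothesis nonstandardP : forall u, ~ std u <-> exists2 v, G v & (v <= u)%MM.

Implicit Types (f : {ffun 'I_m -> 'I_N}).

(** * Selectors, the tuples behind the monomials of multidegree (1, ..., 1) *)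

Definition selector f := forall j, g (f j) = j.
Definition selpt f : 'rV[int]_d := \sum_j pt (f j).
Definition selmon f : 'X_{1..N} := [multinom (f (g i) == i : nat) | i < N].

Variables (M : nat) (b : 'I_M -> 'rV[int]_d).
Hypothesis b_inj : injective b.
Hypothesis b_selector : forall k, exists2 f, selector f & b k = selpt f.
Hypothesis selector_b : forall f, selector f -> exists k, b k = selpt f.
Hypothesis relation_exists : forall i1 i2 j,
  i1 != i2 -> g i1 = g i2 -> g i1 != j -> exists u, ~ std u.

Lemma gdegD j u v : gdeg j (u + v)%MM = (gdeg j u + gdeg j v)%N.
Proof. by rewrite /gdeg -big_split; apply: eq_bigr => i _; rewrite mnmDE. Qed.

Lemma gdeg_eq0 u : (forall j, gdeg j u = 0%N) -> u = 0%MM.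
Proof.
move=> H; apply/mnmP => i; rewrite mnm0E; apply/eqP.
have := H (g i); rewrite /gdeg (bigD1 i) //= => /eqP.
by rewrite addn_eq0 => /andP[].
Qed.

Lemma gdeg_selmon f j : selector f -> gdeg j (selmon f) = 1%N.
Proof.
move=> sf; rewrite /gdeg (bigD1 (f j)) ?sf //= mnmE sf eqxx big1 // => i.
by move=> /andP[/eqP gi ne]; rewrite mnmE gi eq_sym (negbTE ne).
Qed.

Lemma ptsum_selmon f : selector f -> ptsum (selmon f) = selpt f.
Proof.
move=> sf; rewrite /ptsum (partition_big g predT) //=; apply: eq_bigr => j _.
rewrite (bigD1 (f j)) ?sf //= mnmE sf eqxx big1 ?addr0 // => i.
by move=> /andP[/eqP gi ne]; rewrite mnmE gi eq_sym (negbTE ne).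
Qed.

Lemma selmon_inj f f' : selector f -> selector f' -> selmon f = selmon f' -> f = f'.
Proof.
move=> sf sf' e; apply/ffunP => j.
have := congr1 (fun u : 'X_{1..N} => u (f j)) e.
by rewrite !mnmE !sf eqxx; case: eqP.
Qed.

Lemma selector_split u c : (forall j, gdeg j u = c.+1) ->
  exists f, [/\ selector f, (selmon f <= u)%MM
    & forall j i, g i = j -> u i != 0%N -> (f j <= i)%N].
Proof.
move=> H.
have /choice [f fP] : forall j, exists i0, [/\ g i0 = j, u i0 != 0%N
    & forall i, g i = j -> u i != 0%N -> (i0 <= i)%N].
  move=> j; have [i1 /andP[/eqP gi1 ui1]] : exists i, (g i == j) && (u i != 0%N).
    apply: contrapT => nex; have := H j; rewrite /gdeg big1 // => i gi.
    by apply/eqP/negPn/negP => ui; apply: nex; exists i; rewrite gi.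
  have ok1 : (g i1 == j) && (u i1 != 0%N) by rewrite gi1 eqxx.
  case: (@arg_minnP _ i1 (fun i => (g i == j) && (u i != 0%N))
    (fun i => i : nat) ok1) => i0 /andP[/eqP gi0 ui0] imin.
  by exists i0; split=> // i gi ui; apply: imin; rewrite gi eqxx.
have sf : selector [ffun j => f j] by move=> j; rewrite ffunE; case: (fP j).
exists [ffun j => f j]; split=> // [|j i gi ui]; last first.
  by rewrite ffunE; have [_ _] := fP j; apply.
apply/mnm_lepP => i; rewrite mnmE ffunE; case: eqP => // e.
by have [_] := fP (g i); rewrite e -lt0n.
Qed.

Lemma gdeg1_selmon u : (forall j, gdeg j u = 1%N) ->
  exists2 f, selector f & u = selmon f.
Proof.
move=> gu; have [f [sf le _]] := selector_split gu; exists f => //.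
rewrite -(submK le); suff -> : (u - selmon f)%MM = 0%MM by rewrite add0m.
apply: gdeg_eq0 => j; have := gu j.
by rewrite -{1}(submK le) gdegD (gdeg_selmon j sf) addn1 => -[].
Qed.

(** Fibres preserve the multidegree, so the standard form of a selector monomial is again one. *)
Lemma standard_selector k : exists f,
  [/\ selector f, b k = selpt f & std (selmon f)].
Proof.
have [f0 sf0 bf0] := b_selector k.
have [v /fiberE [pv gv] sv] := standard_form a ordP (selmon f0).
have [|f sf vE] := @gdeg1_selmon v; first by move=> j; rewrite -gv gdeg_selmon.
by exists f; rewrite -vE; split=> //; rewrite bf0 -!ptsum_selmon // -vE.
Qed.

Definition sel k : {ffun 'I_m -> 'I_N} := projT1 (cid (standard_selector k)).

Lemma selP k : [/\ selector (sel k), b k = selpt (sel k) & std (selmon (sel k))].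
Proof. exact: projT2 (cid (standard_selector k)). Qed.

Lemma sel_selector k : selector (sel k). Proof. by case: (selP k). Qed.

Lemma sel_inj : injective sel.
Proof.
move=> k k' e; apply: b_inj.
by have [_ -> _] := selP k; have [_ -> _] := selP k'; rewrite e.
Qed.

Lemma sel_surj f : selector f -> std (selmon f) -> exists k, sel k = f.
Proof.
move=> sf stf; have [k bk] := selector_b sf; exists k.
have [sk bk' stk] := selP k; apply: selmon_inj => //.
apply: (standard_uniq ordP stk stf); apply/fiberE; split=> [|j].
  by rewrite !ptsum_selmon // -bk -bk'.
by rewrite !gdeg_selmon.
Qed.

(* Substitutes for every variable the standard monomial of its lattice point. *)
Definition phi (u : 'X_{1..M}) : 'X_{1..N} :=
  (\big[mnm_add/0]_k (selmon (sel k) *+ u k))%MM.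

Lemma phiE (u : 'X_{1..M}) i : phi u i = (\sum_k (sel k (g i) == i) * u k)%N.
Proof. by rewrite /phi mnm_sumE; apply: eq_bigr => k _; rewrite mulmnE mnmE. Qed.

Lemma phiD u v : phi (u + v)%MM = (phi u + phi v)%MM.
Proof.
apply/mnmP => i; rewrite mnmDE !phiE -big_split; apply: eq_bigr => k _ /=.
by rewrite mnmDE mulnDr.
Qed.

Lemma phi0 : phi 0%MM = 0%MM.
Proof. by apply/mnmP => i; rewrite phiE mnm0E big1 // => k _; rewrite mnm0E muln0. Qed.

Lemma phi1 k : phi U_(k)%MM = selmon (sel k).
Proof.
apply/mnmP => i; rewrite phiE (bigD1 k) //= big1 => [|k' ne].
  by rewrite mnm1E eqxx muln1 addn0 mnmE.
by rewrite mnm1E (eq_sym k) (negbTE ne) muln0.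
Qed.

Lemma gdeg_phi j u : gdeg j (phi u) = mdeg u.
Proof.
rewrite /gdeg; under eq_bigr do rewrite phiE.
rewrite exchange_big mdegE; apply: eq_bigr => k _ /=.
rewrite -big_distrl /=; have := gdeg_selmon j (sel_selector k).
by rewrite /gdeg; under eq_bigr do rewrite mnmE; move=> ->; rewrite mul1n.
Qed.

Lemma ptsum_phi u : ptsum (phi u) = \sum_k b k *+ u k.
Proof.
rewrite /ptsum; under eq_bigr do rewrite phiE -sumrMnr.
rewrite exchange_big; apply: eq_bigr => k _ /=.
have [sk -> _] := selP k; rewrite -ptsum_selmon // /ptsum -sumrMnl.
by apply: eq_bigr => i _; rewrite mnmE mulrnA.
Qed.

(** [phi] keeps the sum of the points and turns degree k into multidegree (k, ..., k). *)
Lemma fiber_phi u v : fiber b u v <-> fiber a (phi u) (phi v).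
Proof.
rewrite fiberE !ptsum_phi; split=> [uv|[puv guv]].
  split=> [|j]; last by rewrite !gdeg_phi (fiber_mdeg uv).
  by apply/rowP => j; rewrite -(expo_lshift b u) -(expo_lshift b v) uv.
have deg : mdeg u = mdeg v.
  by have := guv (Ordinal m_gt0); rewrite !gdeg_phi.
apply/rowP => j; case: (split_ordP j) => k ->; first by rewrite !expo_lshift puv.
by rewrite (ord1 k) !expo_mdeg deg.
Qed.

Lemma phi_eq0 u : phi u = 0%MM -> u = 0%MM.
Proof.
move=> e; apply/eqP; rewrite -mdeg_eq0 -(gdeg_phi (Ordinal m_gt0)) e.
by rewrite /gdeg big1 // => i _; rewrite mnm0E.
Qed.

(** Selectors are split off one by one; each divides a standard monomial, so it is the chosen tuple
    of its point. *)
Lemma phi_surj c v : std v -> (forall j, gdeg j v = c) -> exists u, phi u = v.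
Proof.
elim: c v => [|c IHc] v sv gv; first by exists 0%MM; rewrite phi0 (gdeg_eq0 gv).
have [f [sf le _]] := selector_split gv.
have [k kf] := sel_surj sf (standard_le ordP le sv).
have [j||u uE] := IHc (v - selmon f)%MM.
- exact: (standard_le ordP (lem_subr _ _) sv).
- move=> j; have := gv j; rewrite -{1}(submK le) gdegD (gdeg_selmon j sf) addn1.
  by case.
by exists (u + U_(k))%MM; rewrite phiD uE phi1 kf submK.
Qed.

(** * Chains of tuples *)

Definition sel_le k k' := [forall j, (sel k j <= sel k' j)%N].

Definition chain (u : 'X_{1..M}) :=
  forall k k', u k != 0%N -> u k' != 0%N -> sel_le k k' || sel_le k' k.

Lemma chain_le u v : (u <= v)%MM -> chain v -> chain u.
Proof.
move=> /mnm_lepP uv cv k k' uk uk'; apply: cv; rewrite -lt0n.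
  by apply: leq_trans (uv k); rewrite lt0n.
by apply: leq_trans (uv k'); rewrite lt0n.
Qed.

Definition rank k := (\sum_j sel k j)%N.

Lemma chain_min u : chain u -> u <> 0%MM ->
  exists2 k, u k != 0%N & forall k', u k' != 0%N -> sel_le k k'.
Proof.
move=> cu un0; have [k0 uk0] : exists k, u k != 0%N.
  apply: contrapT => nex; apply: un0; apply/mnmP => k; rewrite mnm0E.
  by apply/eqP/negPn/negP => uk; apply: nex; exists k.
case: (@arg_minnP _ k0 (fun k => u k != 0%N) rank uk0) => k uk kmin.
exists k => // k' uk'; case/orP: (cu _ _ uk uk') => // le.
have eqs j : sel k' j = sel k j :> nat.
  apply/eqP; rewrite eqn_leq (forallP le j) /=.
  rewrite leqNgt; apply/negP => lt; have := kmin _ uk'; rewrite leqNgt => /negP; apply.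
  rewrite /rank (bigD1 j) //= [X in (_ < X)%N](bigD1 j) //= -addSn leq_add //.
  by apply: leq_sum => i _; apply: (forallP le).
by apply/forallP => j; rewrite eqs.
Qed.

Lemma phi_supp (u : 'X_{1..M}) i : phi u i != 0%N -> exists2 k, u k != 0%N & sel k (g i) = i.
Proof.
move=> ne; apply: contrapT => nex; move/eqP: ne; apply; rewrite phiE big1 // => k _.
case: eqP => [e|_]; last by rewrite mul0n.
have [->|uk] := eqVneq (u k) 0%N; first by rewrite muln0.
by case: nex; exists k.
Qed.

Lemma phi_sel (u : 'X_{1..M}) k j : u k != 0%N -> phi u (sel k j) != 0%N.
Proof.
move=> uk; rewrite phiE (bigD1 k) //= (sel_selector k j) eqxx mul1n.
by rewrite addn_eq0 negb_and uk.
Qed.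

(** The least tuple of a chain can be read off from the image: its j-th entry is the smallest
    variable of group j that occurs. So u and v have the same least tuple, which is cancelled. *)
Lemma chain_uniq u v : chain u -> chain v -> phi u = phi v -> u = v.
Proof.
have [c] := ubnP (mdeg u); elim: c u v => [//|c IHc] u v uc cu cv uv.
have [u0|un0] := pselect (u = 0%MM).
  by move: uv; rewrite u0 phi0 => /esym /phi_eq0 ->.
have vn0 : v <> 0%MM by move=> v0; apply/un0/phi_eq0; rewrite uv v0 phi0.
have [k uk kmin] := chain_min cu un0; have [k' vk' k'min] := chain_min cv vn0.
have le k1 k2 (u1 u2 : 'X_{1..M}) : phi u1 = phi u2 -> u2 k2 != 0%N ->
    (forall k', u1 k' != 0%N -> sel_le k1 k') -> sel_le k1 k2.
  move=> e u2k2 min1; apply/forallP => j.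
  have := phi_sel j u2k2; rewrite -e => /phi_supp [k3 u1k3].
  rewrite (sel_selector k2 j) => <-; exact: (forallP (min1 _ u1k3)).
have kk' : k = k'.
  apply: sel_inj; apply/ffunP => j; apply/val_inj/eqP; rewrite eqn_leq.
  by rewrite (forallP (le _ _ _ _ uv vk' kmin)) (forallP (le _ _ _ _ (esym uv) uk k'min)).
subst k'.
have leu : (U_(k) <= u)%MM by rewrite lep1mP.
have lev : (U_(k) <= v)%MM by rewrite lep1mP.
rewrite -(submK leu) -(submK lev); congr (_ + _)%MM; apply: IHc.
- by move: uc; rewrite -{1}(submK leu) mdegD mdeg1 addn1 ltnS.
- exact: chain_le (lem_subr _ _) cu.
- exact: chain_le (lem_subr _ _) cv.
by apply: (@addIm _ (phi U_(k)%MM)); rewrite -!phiD !submK.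
Qed.

(** * The monomial order for the Minkowski sum *)

Definition wsq (u : 'X_{1..M}) := (\sum_k u k * rank k ^ 2)%N.

Lemma wsqD u v : wsq (u + v)%MM = (wsq u + wsq v)%N.
Proof.
by rewrite /wsq -big_split; apply: eq_bigr => k _; rewrite mnmDE mulnDl.
Qed.

Lemma wsq1 k : wsq U_(k)%MM = (rank k ^ 2)%N.
Proof.
rewrite /wsq (bigD1 k) //= mnm1E eqxx mul1n big1 ?addn0 // => k' ne.
by rewrite mnm1E (eq_sym k) (negbTE ne).
Qed.

(* The reversed comparison of wsq makes products along chains smallest. *)
Definition diag_ord : rel 'X_{1..M} := fun u v =>
  if phi u == phi v then (wsq v < wsq u)%N || ((wsq v == wsq u) && (u <= v)%O)
  else ord (phi u) (phi v).

(** Reversing [wsq] is harmless: it is additive and only compares monomials with the same image, and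
    1 is the only monomial with image 1, so it remains the smallest. *)
Lemma diag_ordP : monomial_order diag_ord.
Proof.
case: (ordP) => tot anti tr mon pos; split.
- move=> u v; rewrite /diag_ord eq_sym; case: ifP => _; last exact: tot.
  by case: ltngtP => //= _; rewrite ?orbT ?le_total.
- move=> u v /andP[]; rewrite /diag_ord eq_sym; case: eqVneq => [_|ne h1 h2].
    by case: ltngtP => //= _ h1 h2; apply/eqP; rewrite eq_le h1.
  by case/eqP: ne; apply: anti; rewrite h1 h2.
- move=> v u t; rewrite /diag_ord.
  case: (eqVneq (phi u) (phi v)) => [->|uv].
    case: (eqVneq (phi v) (phi t)) => // _ /orP[h1|/andP[/eqP h1 le1]] /orP[h2|/andP[/eqP h2 le2]];
      apply/orP; [left; lia|left; lia|left; lia|right].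
    by rewrite h2 h1 eqxx; exact: le_trans le1 le2.
  case: (eqVneq (phi v) (phi t)) => [<-|vt]; first by rewrite (negbTE uv).
  move=> h1 h2; case: (eqVneq (phi u) (phi t)) => [e|_]; last exact: tr h2.
  by case/eqP: uv; apply: anti; rewrite h1 e h2.
- move=> u v t; rewrite /diag_ord !phiD !wsqD eqm_add2r ltn_add2r eqn_add2r.
  by rewrite lemc_add2l; case: ifP => // _; apply: mon.
- move=> u; rewrite /diag_ord phi0; case: eqVneq => [/esym /phi_eq0 ->|_] //.
  by rewrite eqxx lexx orbT.
Qed.

Local Notation dstd := (standard b diag_ord).

(** The standard form of [phi u] is itself some [phi u'], by [phi_surj]; were it smaller, u' would
    precede u in its fibre. *)
Lemma dstd_phi u : dstd u -> std (phi u).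
Proof.
move=> du; have [v fv sv] := standard_form a ordP (phi u).
have [j|u' u'v] := @phi_surj (mdeg u) v sv.
  by have /fiberE [_ <-] := fv; rewrite gdeg_phi.
have /du : fiber b u u' by apply/fiber_phi; rewrite u'v.
rewrite /diag_ord u'v; case: eqVneq => [-> //|ne] le.
case: ordP => _ anti _ _ _; case/eqP: ne; apply: anti; rewrite le /=.
exact: (sv _ (esym fv)).
Qed.

(* Replacing an incomparable pair by its meet and join increases the sum of the
   squares of the ranks. *)
Lemma dstd_chain u : dstd u -> chain u.
Proof.
move=> du k k' uk uk'; apply: contrapT => /negP; rewrite negb_or => /andP[nk nk'].
have kk' : k != k'.
  by apply: contraNneq nk => ->; apply/forallP => j.
pose meet : {ffun 'I_m -> 'I_N} :=
  [ffun j => if (sel k j <= sel k' j)%N then sel k j else sel k' j].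
pose join : {ffun 'I_m -> 'I_N} :=
  [ffun j => if (sel k j <= sel k' j)%N then sel k' j else sel k j].
have smeet : selector meet.
  by move=> j; rewrite ffunE; case: ifP => _; apply: sel_selector.
have sjoin : selector join.
  by move=> j; rewrite ffunE; case: ifP => _; apply: sel_selector.
have mj : (selmon meet + selmon join = selmon (sel k) + selmon (sel k'))%MM.
  apply/mnmP => i; rewrite !mnmDE !mnmE !ffunE; case: ifP => // _.
  by rewrite addnC.
have ule : (U_(k) + U_(k') <= u)%MM.
  apply/mnm_lepP => i; rewrite mnmDE !mnm1E.
  case: eqVneq => [<-|_]; last by case: eqVneq => [<-|_]; rewrite //= lt0n.
  by rewrite eq_sym (negbTE kk') /= lt0n.
have phile : (selmon (sel k) + selmon (sel k') <= phi u)%MM.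
  by rewrite -(submK ule) !phiD !phi1 lem_addl.
have stu := dstd_phi du.
have [|km kmE] := sel_surj smeet.
  apply: (standard_le ordP) stu; apply: lepm_trans phile.
  by rewrite -mj lem_addr.
have [|kj kjE] := sel_surj sjoin.
  apply: (standard_le ordP) stu; apply: lepm_trans phile.
  by rewrite -mj lem_addl.
pose r := (u - (U_(k) + U_(k')))%MM.
have uE : u = (r + (U_(k) + U_(k')))%MM by rewrite submK.
pose u' := (r + (U_(km) + U_(kj)))%MM.
have pu' : phi u' = phi u.
  by rewrite /u' uE !phiD !phi1 kmE kjE mj.
have : diag_ord u u' by apply: du; apply/fiber_phi; rewrite /fiber pu'.
have wu : wsq u = (wsq r + (rank k ^ 2 + rank k' ^ 2))%N.
  by rewrite uE !wsqD !wsq1.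
have wu' : wsq u' = (wsq r + (rank km ^ 2 + rank kj ^ 2))%N.
  by rewrite !wsqD !wsq1.
rewrite /diag_ord pu' eqxx wu wu' ltn_add2l eqn_add2l.
have sumr : (rank km + rank kj = rank k + rank k')%N.
  rewrite /rank -!big_split; apply: eq_bigr => j _; rewrite kmE kjE !ffunE /=.
  by case: ifP => // _; rewrite addnC.
have ltmeet k1 k2 : (forall j, sel km j <= sel k1 j)%N ->
    (forall j, sel km j <= sel k2 j)%N -> ~~ sel_le k1 k2 -> (rank km < rank k1)%N.
  move=> h1 h2; rewrite negb_forall => /existsP [j]; rewrite -ltnNge => lt.
  rewrite /rank (bigD1 j) //= [X in (_ < X)%N](bigD1 j) //= -addSn leq_add //.
    exact: leq_ltn_trans (h2 j) lt.
  exact: leq_sum.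
have mk j : (sel km j <= sel k j)%N.
  by rewrite kmE ffunE; case: (leqP (sel k j)) => // /ltnW.
have mk' j : (sel km j <= sel k' j)%N.
  by rewrite kmE ffunE; case: (leqP (sel k j)).
(* The meet ranks strictly below both tuples while the sum of the ranks is unchanged: the pair of
   ranks is spread apart. *)
have lt1 := ltmeet _ _ mk mk' nk; have lt2 := ltmeet _ _ mk' mk nk'.
have -> : (rank km ^ 2 + rank kj ^ 2 < rank k ^ 2 + rank k' ^ 2)%N = false.
  by apply/negP; rewrite !expnS !expn0 !muln1 => h; nia.
have -> : (rank km ^ 2 + rank kj ^ 2 == rank k ^ 2 + rank k' ^ 2)%N = false.
  by apply/eqP; rewrite !expnS !expn0 !muln1 => h; nia.
by [].
Qed.

(** For the converse, the standard form of u is a product along a chain whose image is standard,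
    hence equal to [phi u]; [chain_uniq] concludes. *)
Lemma dstdP u : dstd u <-> std (phi u) /\ chain u.
Proof.
split=> [du|[su cu]]; first by split; [exact: dstd_phi|exact: dstd_chain].
have [v uv dv] := standard_form b diag_ordP u.
suff -> : u = v by [].
apply: chain_uniq (dstd_chain dv) _ => //.
by apply: (standard_uniq ordP su (dstd_phi dv)); apply/fiber_phi.
Qed.

(** * Squarefree obstructions to being standard *)

Lemma mdeg_mnm_ind (K : nat) (s : {set 'I_K}) : mdeg (mnm_ind s) = #|s|.
Proof.
rewrite mdegE -sum1_card [RHS]big_mkcond /=; apply: eq_bigr => i _.
by rewrite mnm_indE; case: ifP.
Qed.

(** A generator of degree at most 1 would be 1 or a variable, and these are alone in their fibres,
    for variables because [a] is injective. *)
Lemma standard_linear : (l <= 1)%N -> forall u, std u.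
Proof.
move=> l1 u; apply: contrapT => /nonstandardP [v Gv _].
have [vsq vl] := G_squarefree Gv.
have /nonstandardP : exists2 v', G v' & (v' <= v)%MM.
  by exists v => //; exact: lepm_refl.
apply; have := leq_trans vl l1; case: ltngtP => // [|/eqP + _].
  rewrite ltnS leqn0 mdeg_eq0 => /eqP -> _; exact: standard0.
rewrite mdeg_eq1 => /existsP[i /eqP ->] t ft; have := fiber_mdeg ft.
rewrite mdeg1 => /esym/eqP; rewrite mdeg_eq1 => /existsP[i' /eqP ti'].
move: ft; rewrite ti' /fiber !expo1 => /eq_row_mx [/a_inj -> _].
by case: ordP => tot _ _ _ _; have := tot U_(i')%MM U_(i')%MM; rewrite orbb.
Qed.

Lemma diagonal_squarefree : exists (ord' : rel 'X_{1..M}) (G' : set 'X_{1..M}),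
  [/\ monomial_order ord',
      forall u, G' u -> (forall k, (u k <= 1)%N) /\ (mdeg u <= l)%N
    & forall u, ~ standard b ord' u <-> exists2 v, G' v & (v <= u)%MM].
Proof.
exists diag_ord, [set v : 'X_{1..M} | [/\ (forall k, (v k <= 1)%N), (mdeg v <= l)%N & ~ dstd v]].
split=> [|u []|u] //; first exact: diag_ordP.
split=> [Nu|[v [_ _ Nv] vu] du]; last first.
  by apply: Nv; apply: (standard_le diag_ordP) vu du.
suff [s [sl su Ns]] : exists s : {set 'I_M},
    [/\ (#|s| <= l)%N, (mnm_ind s <= u)%MM & ~ dstd (mnm_ind s)].
  exists (mnm_ind s) => //; split=> // [k|]; last by rewrite mdeg_mnm_ind.
  by rewrite mnm_indE leq_b1.
have [su|/nonstandardP [v Gv vu]] := pselect (std (phi u)).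
  have /existsNP [k /existsNP [k' ]] : ~ chain u by move=> cu; apply/Nu/dstdP.
  move/not_implyP => [uk /not_implyP [uk' /negP inc]].
  exists [set k; k']%SET; split; last 1 first.
  - move=> /dstdP [_] /(_ k k'); rewrite !mnm_indE !inE !eqxx orbT (negbTE inc).
    by move=> /(_ isT isT).
  - rewrite cards2; apply: (@leq_trans 2); first by case: (k != k').
    (* Incomparable tuples differ in opposite directions at two indices [j1] and [j2]; two distinct
       points of the summand [j1] and another summand [j2] produce a nonstandard monomial. *)
    rewrite ltnNge; apply/negP => l1; move: inc; rewrite negb_or => /andP[nk nk'].
    move: nk nk'; rewrite !negb_forall => /existsP[j1 nj1] /existsP[j2 nj2].
    rewrite -ltnNge in nj1; rewrite -ltnNge in nj2.
    have [|||t] := @relation_exists (sel k j1) (sel k' j1) j2.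
    + by rewrite -val_eqE /= neq_ltn nj1 orbT.
    + by rewrite !sel_selector.
    + rewrite sel_selector; apply: contraTneq nj2 => <-.
      by rewrite -leqNgt ltnW.
    by case; apply: standard_linear.
  - rewrite mnm_ind_le; apply/fintype.subsetP => i; rewrite !inE.
    by case/orP => /eqP ->.
have [vsq vl] := G_squarefree Gv.
(* For each variable of the generator v, one tuple of u through it is kept; at most [mdeg v] tuples
   then have an image divisible by v. *)
have /choice [ka kaP] : forall i : {i | v i != 0%N},
    exists k, u k != 0%N /\ sel k (g (val i)) = val i.
  move=> [i /= vi]; have : phi u i != 0%N.
    by rewrite -lt0n; apply: leq_trans (mnm_lepP vu i); rewrite lt0n.
  by case/phi_supp => k uk ki; exists k.
exists (ka @: [set: {i | v i != 0%N}])%SET; split.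
- apply: leq_trans vl; apply: leq_trans (leq_imset_card _ _) _.
  rewrite cardsT card_sig mdegE -sum1_card [leqLHS]big_mkcond /=; apply: leq_sum => i _.
  by rewrite inE -lt0n; case: (v i).
- rewrite mnm_ind_le; apply/fintype.subsetP => k /imsetP[i _ ->].
  by rewrite inE; have [] := kaP i.
- move=> /dstdP [+ _]; apply/nonstandardP; exists v => //.
  apply/mnm_lepP => i; have [->//|vi] := eqVneq (v i) 0%N.
  apply: leq_trans (vsq i) _; rewrite lt0n.
  have [_ /= <-] := kaP (exist _ i vi).
  by apply: phi_sel; rewrite mnm_indE eqb0 negbK; apply/imset_f.
Qed.

End DiagonalConfiguration.

(** A squarefree generator that divides u already divides its squarefree part. *)
Lemma squarefree_standard n N (a : 'I_N -> 'rV[int]_n) ord (G : set 'X_{1..N}) l :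
  (forall u, G u -> (forall i, (u i <= 1)%N) /\ (mdeg u <= l)%N) ->
  (forall u, ~ standard a ord u <-> exists2 v, G v & (v <= u)%MM) ->
  forall u, standard a ord (mnm_ind (mnm_supp u)) -> standard a ord u.
Proof.
move=> Gsq GE u su; apply: contrapT => /GE [v Gv /mnm_lepP vu].
have /GE : exists2 v, G v & (v <= mnm_ind (mnm_supp u))%MM; last exact.
exists v => //; apply/mnm_lepP => i; rewrite mnm_indE inE.
have := vu i; have [/(_ i) + _] := Gsq v Gv.
by case: (u i) => //= _ _; rewrite leqn0.
Qed.

Lemma triangulation_IDP_of_squarefree (K : fieldType) (R : realType) (n : nat)
    (Q : set 'rV[R]_n) l :
  Q = conv [set int_vec R z | z in lattice_points Q] -> lattice_spanning Q ->
  has_squarefree_initial_ideal K Q l ->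
  has_regular_unimodular_triangulation Q /\ IDP Q.
Proof.
move=> Qc Qs /squarefree_initial_idealP [N [a [inj aQ [ord [G [ordP Gsq GE]]]]]].
have sq := squarefree_standard Gsq GE; split.
  exact: (regular_unimodular_of_squarefree inj aQ Qc ordP sq Qs).
exact: (IDP_of_squarefree aQ Qc ordP sq Qs).
Qed.

Lemma int_vec_sum (R : realType) (n : nat) (I : finType) (z : I -> 'rV[int]_n) :
  int_vec R (\sum_i z i) = \sum_i int_vec R (z i).
Proof.
apply/rowP => j; rewrite mxE !summxE rmorph_sum.
by apply: eq_bigr => i _; rewrite mxE.
Qed.

(* The weights are those of the product of the distributions la j. *)
Lemma product_marginal (F : comNzRingType) (J I : finType) (la : J -> I -> F)
    (v : I -> F) j0 : (forall j, \sum_i la j i = 1) ->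
  \sum_(f : {ffun J -> I}) (\prod_j la j (f j)) * v (f j0) = \sum_i la j0 i * v i.
Proof.
move=> la1; pose mu j i := la j i * (if j == j0 then v i else 1).
have -> : \sum_(f : {ffun J -> I}) (\prod_j la j (f j)) * v (f j0) =
    \sum_(f : {ffun J -> I}) \prod_j mu j (f j).
  apply: eq_bigr => f _; rewrite big_split /=; congr (_ * _).
  by rewrite (bigD1 j0) //= eqxx big1 ?mulr1 // => j /negbTE ->.
rewrite -bigA_distr_bigA (bigD1 j0) //= [X in _ * X]big1 ?mulr1 => [|j ne].
  by apply: eq_bigr => i _; rewrite /mu eqxx.
by rewrite -[RHS](la1 j); apply: eq_bigr => i _; rewrite /mu (negbTE ne) mulr1.
Qed.

(** * Transfer between the Cayley sum and the Minkowski sum *)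

Section CayleyMinkowski.
Variables (R : realType) (d m : nat) (P : 'I_m -> set 'rV[R]_d).
Hypothesis m_gt0 : (0 < m)%N.
Hypothesis P_lattice : forall i, lattice_polytope (P i).
Hypothesis P_span : forall i, lattice_spanning (P i).
Variables (N : nat) (a : 'I_N -> 'rV[int]_(d + m.-1)).
Variables (g : 'I_N -> 'I_m) (pt : 'I_N -> 'rV[int]_d).
Hypothesis aE : forall i, a i = row_mx (pt i) (cay_int (g i)).
Hypothesis pt_lattice : forall i, lattice_points (P (g i)) (pt i).
Hypothesis pt_surj : forall j p, lattice_points (P j) p -> exists2 i, g i = j & pt i = p.

Local Notation widen := (widen_ord (leq_pred m)).
Local Notation C := (cayley_sum P).
Local Notation M := (minkowski_sum P).
Implicit Types (f : {ffun 'I_m -> 'I_N}).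

Lemma sum_gdeg u : (\sum_j gdeg g j u)%N = mdeg u.
Proof. by rewrite mdegE [RHS](partition_big g predT). Qed.

Lemma gdeg_cayley (u : 'X_{1..N}) l : (\sum_i a i *+ u i) 0 (rshift d l) = (gdeg g (widen l) u)%:Z.
Proof.
rewrite summxE /gdeg (big_morph Posz PoszD (erefl (Posz 0))) [RHS]big_mkcond /=.
apply: eq_bigr => i _; rewrite mulmxnE aE row_mxEr mxE -val_eqE /= eq_sym.
by case: eqP => _; rewrite ?natz ?mul0rn.
Qed.

Lemma ptsum_cayley (u : 'X_{1..N}) j : (\sum_i a i *+ u i) 0 (lshift (m.-1) j) = ptsum pt u 0 j.
Proof.
rewrite /ptsum !summxE; apply: eq_bigr => i _.
by rewrite !mulmxnE aE row_mxEl.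
Qed.

(** The Cayley vectors record only m - 1 of the multidegrees; the total degree supplies the last
    one. *)
Lemma gdeg_last u v : mdeg u = mdeg v ->
  (forall l, gdeg g (widen l) u = gdeg g (widen l) v) ->
  forall j, gdeg g j u = gdeg g j v.
Proof.
move=> uv H j; have [[l ->]|e] := ord_split m_gt0 j; first exact: H.
move: uv; rewrite -!sum_gdeg (bigD1 j) //= [RHS](bigD1 j) //=.
rewrite [X in (_ + X)%N = _](eq_bigr (fun i => gdeg g i v)); first exact: addIn.
move=> i ij; have [[l ->]|e'] := ord_split m_gt0 i; first exact: H.
by case/eqP: ij; apply/val_inj; rewrite /= e e'.
Qed.

Lemma fiber_cayley u v :
  fiber a u v <-> ptsum pt u = ptsum pt v /\ forall j, gdeg g j u = gdeg g j v.
Proof.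
split=> [uv|[puv guv]].
  have e j : (\sum_i a i *+ u i) 0 j = (\sum_i a i *+ v i) 0 j.
    by rewrite -(expo_lshift a u) -(expo_lshift a v) uv.
  split; first by apply/rowP => j; rewrite -!ptsum_cayley e.
  apply: gdeg_last (fiber_mdeg uv) _ => l.
  by have := e (rshift d l); rewrite !gdeg_cayley => -[].
apply/rowP => j; case: (split_ordP j) => k ->; last first.
  by rewrite (ord1 k) !expo_mdeg -!sum_gdeg (eq_bigr _ (fun j _ => guv j)).
rewrite !expo_lshift; case: (split_ordP k) => l ->.
  by rewrite !ptsum_cayley puv.
by rewrite !gdeg_cayley guv.
Qed.

Lemma group_span j (y : 'rV[int]_d) (h : int) : exists e : 'I_N -> int,
  [/\ forall i, g i != j -> e i = 0, forall l, \sum_i pt i 0 l * e i = y 0 l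
    & \sum_i e i = h].
Proof.
have : [set: 'rV[int]_(d + 1)] (row_mx y (const_mx h)) by [].
rewrite -(P_span j) => /(int_span_combination (t := [set i | g i == j]%SET)
  (c := fun i => row_mx (pt i) (const_mx 1 : 'rV[int]_1))) [z|e [et eE]].
  by move=> [p Pp <-]; have [i gi <-] := pt_surj Pp; exists i; rewrite ?inE ?gi.
have entry k : \sum_i row_mx (pt i) (const_mx 1 : 'rV_1) 0 k * e i =
    row_mx y (const_mx h : 'rV_1) 0 k.
  rewrite -eE summxE; apply: eq_bigr => i _.
  by rewrite -scaler_int [RHS]mxE intz mulrC.
exists e; split=> [i gi|l|]; first by apply: et; rewrite inE.
  have := entry (lshift 1 l); rewrite row_mxEl => <-.
  by apply: eq_bigr => i _; rewrite row_mxEl.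
have := entry (rshift d 0); rewrite row_mxEr mxE => <-.
by apply: eq_bigr => i _; rewrite row_mxEr mxE mul1r.
Qed.

Lemma sum_cay_int j (e : 'I_N -> int) l : (forall i, g i != j -> e i = 0) ->
  \sum_i cay_int (g i) 0 l * e i = cay_int j 0 l * \sum_i e i.
Proof.
move=> ej; rewrite mulr_sumr; apply: eq_bigr => i _.
by have [->//|/ej ->] := eqVneq (g i) j; rewrite !mulr0.
Qed.

Lemma selector_exists : exists f, selector g f.
Proof.
have /choice [f fP] : forall j, exists i, g i = j.
  move=> j; have [e [ej _ e1]] := group_span j 0 1.
  apply: contrapT => nex; move/eqP: e1; rewrite big1 // => i _.
  by apply: ej; apply/eqP => gi; apply: nex; exists i.
by exists [ffun j => f j] => j; rewrite ffunE.
Qed.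

(** The difference of two points of one summand is an integral combination, with coefficient sum 0,
    of the points of the summand j. The two sides of this relation share a fibre and differ at [i1],
    so they are not both standard. *)
Lemma cayley_relation ord i1 i2 j : i1 != i2 -> g i1 = g i2 -> g i1 != j ->
  monomial_order ord -> exists u, ~ standard a ord u.
Proof.
move=> ne g12 g1j ordP.
have [e [ej ept e0]] := group_span j (pt i1 - pt i2) 0.
pose z i : int := (i == i1)%:R - (i == i2)%:R - e i.
have delta (F : 'I_N -> int) k : \sum_i F i * (i == k)%:R = F k.
  rewrite (bigD1 k) //= eqxx mulr1 big1 ?addr0 // => i /negbTE ->.
  by rewrite mulr0.
have zF F : \sum_i F i * z i = F i1 - F i2 - \sum_i F i * e i.
  rewrite -(delta F i1) -(delta F i2) -!sumrB.
  by apply: eq_bigr => i _; rewrite !mulrBr.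
have zA : forall k, \sum_i z i * hcoord a i k = 0.
  move=> k; under eq_bigr do rewrite mulrC; rewrite zF /hcoord.
  case: (split_ordP k) => k1 ->; last first.
    rewrite !row_mxEr !mxE subrr sub0r -[RHS]oppr0 -[in RHS]e0; congr (- _).
    by apply: eq_bigr => i _; rewrite row_mxEr mxE mul1r.
  under eq_bigr do rewrite row_mxEl aE.
  rewrite !row_mxEl !aE; case: (split_ordP k1) => l ->.
    under eq_bigr do rewrite row_mxEl.
    by rewrite !row_mxEl ept !mxE subrr.
  under eq_bigr do rewrite row_mxEr.
  by rewrite !row_mxEr (sum_cay_int _ ej) e0 mulr0 g12 subrr subr0.
apply: contrapT => nex.
have all_std u : standard a ord u by apply: contrapT => Nu; apply: nex; exists u.
have e12 := standard_uniq ordP (all_std _) (all_std _) (fiber_pos zA).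
have := mnm_posB z i1; by rewrite e12 subrr /z eqxx (negbTE ne) ej.
Qed.

Lemma cayley_spanning : range a `<=` lattice_points C -> lattice_spanning C.
Proof.
move=> aC; apply/seteqP; split=> // x _.
pose y : 'rV_d := lsubmx (lsubmx x); pose c : 'rV_(m.-1) := rsubmx (lsubmx x).
pose h := rsubmx x 0 0.
have lastP : (m.-1 < m)%N by rewrite prednK.
have /choice [e eP] : forall l, exists e : 'I_N -> int,
    [/\ forall i, g i != widen l -> e i = 0,
      forall k, \sum_i pt i 0 k * e i = (0 : 'rV_d) 0 k
      & \sum_i e i = c 0 l] by move=> l; apply: group_span.
(* The last summand has Cayley vector 0: it contributes y and the remaining height without
   disturbing the Cayley coordinates, each of which is set by its own summand. *)
have [e' [e'P e'y e'h]] := group_span (Ordinal lastP) y (h - \sum_l c 0 l).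
pose k i := e' i + \sum_l e l i.
have kE F : \sum_i F i * k i = \sum_i F i * e' i + \sum_l \sum_i F i * e l i.
  rewrite exchange_big -big_split; apply: eq_bigr => i _ /=.
  by rewrite mulrDr mulr_sumr.
have -> : x = \sum_i row_mx (a i) (const_mx 1 : 'rV_1) *~ k i.
  have entry j : (\sum_i row_mx (a i) (const_mx 1 : 'rV_1) *~ k i) 0 j =
      \sum_i row_mx (a i) (const_mx 1 : 'rV_1) 0 j * k i.
    by rewrite summxE; apply: eq_bigr => i _; rewrite -scaler_int mxE intz mulrC.
  apply/rowP => j; rewrite entry kE; case: (split_ordP j) => j1 ->; last first.
    have one (e0 : 'I_N -> int) :
        \sum_i row_mx (a i) (const_mx 1 : 'rV_1) 0 (rshift (d + m.-1) j1) * e0 i =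
        \sum_i e0 i.
      by apply: eq_bigr => i _; rewrite row_mxEr mxE mul1r.
    rewrite one e'h; have -> : x 0 (rshift (d + m.-1) j1) = h.
      by rewrite /h mxE (ord1 j1).
    rewrite [X in _ + X](eq_bigr (fun l => c 0 l)) ?subrK // => l _.
    by rewrite one; have [] := eP l.
  have left (e0 : 'I_N -> int) :
      \sum_i row_mx (a i) (const_mx 1 : 'rV_1) 0 (lshift 1 j1) * e0 i =
      \sum_i row_mx (pt i) (cay_int (g i)) 0 j1 * e0 i.
    by apply: eq_bigr => i _; rewrite row_mxEl aE.
  rewrite left [X in _ + X](eq_bigr _ (fun l _ => left (e l))).
  case: (split_ordP j1) => j2 -> {left}.
    have left (e0 : 'I_N -> int) :
        \sum_i row_mx (pt i) (cay_int (g i)) 0 (lshift _ j2) * e0 i =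
        \sum_i pt i 0 j2 * e0 i.
      by apply: eq_bigr => i _; rewrite row_mxEl.
    rewrite left e'y big1 ?addr0 => [|l _]; first by rewrite !mxE.
    by rewrite left; have [_ -> _] := eP l; rewrite mxE.
  have right (e0 : 'I_N -> int) :
      \sum_i row_mx (pt i) (cay_int (g i)) 0 (rshift d j2) * e0 i =
      \sum_i cay_int (g i) 0 j2 * e0 i.
    by apply: eq_bigr => i _; rewrite row_mxEr.
  rewrite right (sum_cay_int _ e'P) mxE /= ltn_eqF ?mul0r ?add0r //.
  rewrite (bigD1 j2) //= right [X in _ + X]big1 => [|l ne].
    by have [ej _ ejh] := eP j2; rewrite (sum_cay_int _ ej) mxE /= eqxx mul1r ejh addr0 !mxE.
  have [ej _ ejh] := eP l; rewrite right (sum_cay_int _ ej) mxE /= -[_ == _]/(j2 == l).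
  by rewrite eq_sym (negbTE ne) mul0r.
apply: combination_int_span => i _; exists (a i) => //.
by apply: aC; exists i.
Qed.

Definition selpts : seq 'rV[int]_d :=
  undup [seq selpt pt f | f : {ffun 'I_m -> 'I_N} <- enum {ffun 'I_m -> 'I_N}
     & [forall j, g (f j) == j]].

Definition mink (k : 'I_(size selpts)) : 'rV[int]_d := nth 0 selpts k.

Lemma mink_inj : injective mink.
Proof.
move=> k k' /eqP; rewrite /mink nth_uniq ?undup_uniq ?ltn_ord // => /eqP e.
exact: val_inj.
Qed.

Lemma selptsP z : z \in selpts <-> exists2 f, selector g f & z = selpt pt f.
Proof.
rewrite mem_undup; split=> [/mapP[f]|[f sf ->]].
  by rewrite mem_filter => /andP[/forallP sf _] ->; exists f => // j; apply/eqP.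
by apply: map_f; rewrite mem_filter mem_enum andbT; apply/forallP => j; rewrite sf.
Qed.

Lemma mink_selector k : exists2 f, selector g f & mink k = selpt pt f.
Proof. by apply/selptsP/mem_nth. Qed.

Lemma selector_mink f : selector g f -> exists k, mink k = selpt pt f.
Proof.
move=> sf; have fz : selpt pt f \in selpts by apply/selptsP; exists f.
have ik : (index (selpt pt f) selpts < size selpts)%N by rewrite index_mem.
by exists (Ordinal ik); rewrite /mink nth_index.
Qed.

Lemma selpt_lattice f : selector g f -> lattice_points M (selpt pt f).
Proof.
move=> sf; exists (fun j => int_vec R (pt (f j))); split; last exact: int_vec_sum.
by move=> j; have := pt_lattice (f j); rewrite sf.
Qed.

Lemma mink_lattice :
  (forall z, lattice_points (dilate m C) z ->
     exists u, expo a u = row_mx z (const_mx m%:Z)) ->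
  lattice_points M = range mink.
Proof.
move=> norm; apply/seteqP; split=> [z [y [Py zE]]|_ [k _ <-]]; last first.
  by have [f sf ->] := mink_selector k; apply: selpt_lattice.
pose x : 'rV[int]_(d + m.-1) := row_mx z (const_mx 1).
have mR : (m%:R : R) != 0 by rewrite pnatr_eq0 -lt0n.
have /norm [u ux] : lattice_points (dilate m C) x.
  (* (z, 1, ..., 1) is m times the mean of the Cayley lifts of the [y j]. *)
  exists (\sum_j m%:R^-1 *: row_mx (y j) (cayley_vec R j)).
    apply: conv_fintype => [j||j]; first by rewrite invr_ge0.
      by rewrite sumr_const card_ord -(mulr_natl m%:R^-1) divff.
    by exists j => //; exists (y j).
  rewrite -scaler_sumr scalerA divff // scale1r; apply/rowP => k.
  rewrite summxE mxE; case: (split_ordP k) => l ->.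
    have := congr1 (fun v : 'rV_d => v 0 l) zE; rewrite /= mxE row_mxEl => ->.
    by rewrite summxE; apply: eq_bigr => j _; rewrite row_mxEl.
  rewrite row_mxEr mxE (bigD1 (widen l)) //= row_mxEr mxE eqxx big1 ?addr0 // => j ne.
  by rewrite row_mxEr mxE; case: eqP => // e; case/eqP: ne; apply/val_inj.
have [f0 sf0] := selector_exists.
have mu : mdeg u = m.
  by have := expo_mdeg a u; rewrite ux row_mxEr mxE => -[].
have gu : forall j, gdeg g j u = 1%N.
  move=> j; rewrite -(gdeg_selmon j sf0); apply: gdeg_last j => [|l].
    rewrite mu -sum_gdeg (eq_bigr (fun=> 1%N)) ?sum1_card ?card_ord // => j _.
    exact: gdeg_selmon.
  rewrite gdeg_selmon //; have := gdeg_cayley u l; rewrite -expo_lshift ux.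
  by rewrite row_mxEl row_mxEr mxE => -[].
have [f sf uf] := gdeg1_selmon gu.
have [k kf] := selector_mink sf; exists k => //; rewrite kf.
rewrite -(ptsum_selmon pt sf) -uf; apply/rowP => l.
by rewrite -ptsum_cayley -expo_lshift ux row_mxEl row_mxEl.
Qed.

(** With the choices in all summands but [j0] fixed, a translate by q of the lattice points of
    [P j0] lies in the Minkowski sum. Coefficients with sum h shift the result by h q, which is
    subtracted beforehand. *)
Lemma minkowski_spanning : lattice_spanning M.
Proof.
apply/seteqP; split=> // x _.
have [f0 sf0] := selector_exists.
pose j0 := Ordinal m_gt0; pose q := selpt pt f0 - pt (f0 j0).
pose y : 'rV_d := lsubmx x; pose h := rsubmx x 0 0.
have [e [ej ey eh]] := group_span j0 (y - h *: q) h.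
have -> : x = \sum_i row_mx (pt i + q) (const_mx 1 : 'rV_1) *~ e i.
  apply/rowP => j; rewrite summxE; transitivity
      (\sum_i row_mx (pt i + q) (const_mx 1 : 'rV_1) 0 j * e i); last first.
    by apply: eq_bigr => i _; rewrite -scaler_int [RHS]mxE intz mulrC.
  case: (split_ordP j) => l ->; last first.
    rewrite (eq_bigr e) ?eh => [|i _]; first by rewrite /h mxE (ord1 l).
    by rewrite row_mxEr mxE mul1r.
  rewrite (eq_bigr (fun i => pt i 0 l * e i + q 0 l * e i)) => [|i _].
    by rewrite big_split /= ey -mulr_sumr eh !mxE; ring.
  by rewrite row_mxEl mxE mulrDl.
apply: combination_int_span => i ei; exists (pt i + q) => //.
have gi : g i = j0 by apply/eqP; apply: contraNT ei => /ej ->.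
pose f := [ffun j => if j == j0 then i else f0 j].
have sf : selector g f by move=> j; rewrite ffunE; case: eqP => [->|_].
suff -> : pt i + q = selpt pt f by apply: selpt_lattice.
have -> : q = \sum_(j | j != j0) pt (f0 j).
  by rewrite /q /selpt (bigD1 j0) //= addrAC subrr add0r.
rewrite /selpt [RHS](bigD1 j0) //= ffunE eqxx; congr (_ + _).
by apply: eq_bigr => j /negbTE jj; rewrite ffunE jj.
Qed.

(** Choosing independently in each summand a lattice point with distribution [la j] exhibits the sum
    of the [y j] as a mean of selector sums. *)
Lemma minkowski_polytope :
  M = conv [set int_vec R z | z in lattice_points M].
Proof.
apply/seteqP; split=> x; last first.
  move=> [k [w [p [w0 w1 pM ->]]]].
  have /choice [y yP] : forall l, exists y : 'I_m -> 'rV[R]_d,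
      (forall j, P j (y j)) /\ p l = \sum_j y j.
    by move=> l; have [z [y [Py zE]] <-] := pM l; exists y.
  exists (fun j => \sum_l w l *: y l j); split=> [j|].
    rewrite (lattice_polytope_conv (P_lattice j)); apply: conv_convex => // l.
    by rewrite -lattice_polytope_conv //; case: (yP l).
  rewrite exchange_big; apply: eq_bigr => l _ /=.
  by have [_ ->] := yP l; rewrite scaler_sumr.
move=> [y [Py ->]].
have imE j : [set int_vec R z | z in lattice_points (P j)] =
    [set int_vec R (pt i) | i in [set` [set i | g i == j]%SET]].
  apply/seteqP; split=> [_ [z Pz <-]|_ [i + <-]].
    by have [i gi <-] := pt_surj Pz; exists i; rewrite //= inE gi.
  by rewrite /= inE => /eqP <-; exists (pt i).
have /choice [la laP] : forall j, exists la : 'I_N -> R,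
    [/\ forall i, 0 <= la i, forall i, i \notin [set i | g i == j]%SET -> la i = 0,
      \sum_i la i = 1 & y j = \sum_i la i *: int_vec R (pt i)].
  move=> j; apply/conv_image; rewrite -imE -lattice_polytope_conv //.
have la1 j : \sum_i la j i = 1 by case: (laP j).
have [f0 sf0] := selector_exists.
pose w f := \prod_j la j (f j).
have w0 f : ~ selector g f -> w f = 0.
  move/existsNP => [j /eqP nj]; rewrite /w (bigD1 j) //=.
  by have [_ -> //] := laP j; rewrite ?mul0r ?inE.
(* A function that is no selector has weight 0, so [f0] is a mere placeholder that keeps the point
   in the Minkowski sum. *)
pose p f := int_vec R (selpt pt (if `[< selector g f >] then f else f0)).
have -> : \sum_j y j = \sum_f w f *: p f.
  transitivity (\sum_f w f *: \sum_j int_vec R (pt (f j))); last first.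
    apply: eq_bigr => f _; rewrite /p; case: asboolP => [_|/w0 ->].
      by rewrite int_vec_sum.
    by rewrite !scale0r.
  apply/rowP => l; rewrite !summxE.
  under [RHS]eq_bigr do rewrite mxE summxE mulr_sumr.
  rewrite exchange_big; apply: eq_bigr => j _ /=.
  rewrite (product_marginal (fun i => int_vec R (pt i) 0 l) j la1).
  have [_ _ _ ->] := laP j; rewrite summxE.
  by apply: eq_bigr => i _; rewrite mxE.
apply: conv_fintype => [f||f].
- by apply: prodr_ge0 => j _; case: (laP j).
- have := product_marginal (fun=> 1) (Ordinal m_gt0) la1.
  under eq_bigr do rewrite mulr1.
  by under [in X in _ = X -> _]eq_bigr do rewrite mulr1; rewrite la1.
- exists (selpt pt (if `[< selector g f >] then f else f0)) => //.
  by apply: selpt_lattice; case: asboolP.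
Qed.

End CayleyMinkowski.

Local Close Scope classical_set_scope.

Theorem theorem2p2 (R : realType) (K : fieldType) (d m l : nat)
    (P : 'I_m -> set 'rV[R]_d)
    (m_ge2 : (2 <= m)%N)
    (P_lattice : forall i, lattice_polytope (P i))
    (P_dim : forall i, has_dim (P i) d)
    (P_span : forall i, lattice_spanning (P i))
    (cayley_init : has_squarefree_initial_ideal K (cayley_sum P) l) :
  has_squarefree_initial_ideal K (minkowski_sum P) l /\
  (has_regular_unimodular_triangulation (cayley_sum P) /\ IDP (cayley_sum P)) /\
  (has_regular_unimodular_triangulation (minkowski_sum P) /\
   IDP (minkowski_sum P)).
Proof.
have m_gt0 : (0 < m)%N := ltnW m_ge2.
have [N [a [a_inj aC [ord [G [ordP Gsq GE]]]]]] :=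
  (squarefree_initial_idealP K (cayley_sum P) l).1 cayley_init.
have /choice [gp gpP] : forall i, exists gp : 'I_m * 'rV[int]_d,
    lattice_points (P gp.1) gp.2 /\ a i = row_mx gp.2 (cay_int gp.1).
  move=> i; have : lattice_points (cayley_sum P) (a i) by rewrite aC; exists i.
  by move=> /(cayley_latticeP m_gt0 P_lattice) [j [p jp]]; exists (j, p).
pose g i := (gp i).1; pose pt i := (gp i).2.
have aE i : a i = row_mx (pt i) (cay_int (g i)) by case: (gpP i).
have ptP i : lattice_points (P (g i)) (pt i) by case: (gpP i).
have pt_surj j p : lattice_points (P j) p -> exists2 i, g i = j & pt i = p.
  move=> /cayley_lattice; rewrite aC => -[i _]; rewrite aE => /eq_row_mx [ip ij].
  by exists i => //; apply: cay_int_inj ij.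
have Cspan : lattice_spanning (cayley_sum P).
  by apply: (cayley_spanning m_gt0 P_span aE pt_surj); rewrite aC.
have Cconv := cayley_polytope P_lattice.
have sq := squarefree_standard Gsq GE.
have norm z := @normality _ _ _ _ _ aC Cconv _ ordP sq Cspan m z.
have Minit : has_squarefree_initial_ideal K (minkowski_sum P) l.
  apply/squarefree_initial_idealP.
  exists (size (selpts g pt)), (@mink _ _ _ g pt); split; first exact: mink_inj.
    exact: (mink_lattice m_gt0 P_span aE ptP pt_surj norm).
  apply: (diagonal_squarefree m_gt0 a_inj (fiber_cayley m_gt0 aE) ordP Gsq GE).
  - exact: mink_inj.
  - exact: mink_selector.
  - exact: selector_mink.
  - by move=> i1 i2 j h1 h2 h3; apply: (cayley_relation P_span aE pt_surj h1 h2 h3).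
split=> //; split; first exact: triangulation_IDP_of_squarefree cayley_init.
apply: triangulation_IDP_of_squarefree Minit.
  exact: (minkowski_polytope m_gt0 P_lattice P_span ptP pt_surj).
exact: (minkowski_spanning m_gt0 P_span ptP pt_surj).
Qed.
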